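(* Let $p$ be a prime and $r\geq 1$ a natural number. Let $G$ be isomorphic to the group $G_r$ generated by $\alpha_1,\alpha_2,\beta_1,\beta_2,\gamma_1,\gamma_2$ subject to the relations $$[\beta_1,\alpha_1]=\gamma_1=\beta_1^{p^r},\quad [\beta_2,\alpha_2]=\gamma_2=\beta_2^{p^r},\quad [\alpha_1,\alpha_2]=\gamma_2,\quad \gamma_1^{p^r}=\gamma_2^{p^r}=\alpha_1^{p^r}=\alpha_2^{p^r}=1,$$ together with the relations $[x,y]=1$ for all pairs of generators $x,y$ whose commutator is not listed above (so that in particular $\gamma_1,\gamma_2$ are central). Assume that $K$ is any field satisfying either (i) $\operatorname{char} K=p>0$, or (ii) $\operatorname{char} K\neq p$ and $K$ contains a primitive $p^{2r}$-th root of unity. Then $K(G)$ is rational over $K$.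
   Context: Commutators are $[x,y]=x^{-1}y^{-1}xy$. For a field $K$ and a finite group $G$, let $G$ act on the rational function field $K(x(g):g\in G)$ (in $|G|$ independent variables) by $K$-automorphisms defined by $g\cdot x(h)=x(gh)$ for all $g,h\in G$; $K(G)$ denotes the fixed field $K(x(g):g\in G)^G$. A field extension $L$ of $K$ is called rational over $K$ if $L\simeq K(x_1,\ldots,x_m)$ over $K$ for some integer $m$, with $x_1,\ldots,x_m$ algebraically independent over $K$. *)

(* Defs.v *)
From HB Require Import structures.
From mathcomp Require Import all_boot all_order all_fingroup all_algebra.
From mathcomp Require Import mpoly.

Set Implicit Arguments.
Unset Strict Implicit.
Unset Printing Implicit Defensive.

Import GRing.Theory.
Local Open Scope ring_scope.

Notation "x %:F" := (@FracField.tofrac _ x).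

Notation ratfun K n := {fraction {mpoly K[n]}}.

Definition ratfunC (K : fieldType) (n : nat) (c : K) : ratfun K n :=
  (c%:MP_[n])%:F.

HB.instance Definition _ (K : fieldType) (n : nat) :=
  GRing.RMorphism.copy (@ratfunC K n)
    (@FracField.tofrac {mpoly K[n]} \o @mpolyC n K).

(* [iota] is the structure map of [L] as a field extension of [K]. *)
Definition rational_over (K L : fieldType) (iota : {rmorphism K -> L}) : Prop :=
  exists (m : nat) (phi : {rmorphism ratfun K m -> L}),
    bijective phi /\ forall c : K, phi (ratfunC m c) = iota c.

Lemma frac_numden (R : idomainType) (x : {fraction R}) :
  x = (\n_(generic_quotient.repr x))%:F / (\d_(generic_quotient.repr x))%:F.
Proof.
rewrite -{1}[x]reprK; move: (generic_quotient.repr x) => u.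
unlock FracField.tofrac; rewrite -[_^-1]FracField.pi_inv -[RHS]FracField.pi_mul.
rewrite /FracField.mulf /FracField.invf /= !numden_Ratio ?oner_neq0 ?denom_ratioP //.
by rewrite mulr1 mul1r Ratio_numden.
Qed.

Record subfield_of (F : fieldType) (S : divringClosed F) :=
  Subfield { subfield_val :> F; _ : subfield_val \in S }.

Section SubfieldOf.

Variables (F : fieldType) (S : divringClosed F).

HB.instance Definition _ := [isSub for @subfield_val F S].
HB.instance Definition _ := [Choice of subfield_of S by <:].
HB.instance Definition _ := [SubChoice_isSubIntegralDomain of subfield_of S by <:].
HB.instance Definition _ := [SubIntegralDomain_isSubField of subfield_of S by <:].

End SubfieldOf.

Section RegularAction.

Variables (K : fieldType) (gT : finGroupType).
Implicit Types (g h : gT) (p q : {mpoly K[#|gT|]}) (f : ratfun K #|gT|).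

(* The variable x(h) is the one numbered [enum_rank h]. *)
Definition xvar h : ratfun K #|gT| := ('X_(enum_rank h))%:F.

Definition polyact g : {mpoly K[#|gT|]} -> {mpoly K[#|gT|]} :=
  comp_mpoly [tuple 'X_(enum_rank (g * enum_val i)%g) | i < #|gT|].

HB.instance Definition _ g := GRing.RMorphism.copy (polyact g)
  (comp_mpoly [tuple 'X_(enum_rank (g * enum_val i)%g) | i < #|gT|]).

(* The value does not depend on the representative chosen by [repr]: see
   [ratactE]. *)
Definition ratact g f : ratfun K #|gT| :=
  let u := generic_quotient.repr f in (polyact g \n_u)%:F / (polyact g \d_u)%:F.

Lemma polyactC g c : polyact g c%:MP = c%:MP.
Proof. exact: comp_mpolyC. Qed.

Lemma polyactX g h : polyact g 'X_(enum_rank h) = 'X_(enum_rank (g * h)%g).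
Proof. by rewrite /polyact comp_mpolyXU -tnth_nth tnth_mktuple enum_rankK. Qed.

Lemma polyactM g h p : polyact g (polyact h p) = polyact (g * h)%g p.
Proof.
elim/mpolyind: p => [|c m p _ _ IHp]; first by rewrite !rmorph0.
rewrite !rmorphD /= IHp; congr (_ + _).
rewrite -mul_mpolyC !rmorphM /= !polyactC; congr (_ * _).
rewrite mpolyXE_id !rmorph_prod; apply: eq_bigr => i _.
by rewrite !rmorphXn /= -[i]enum_valK !polyactX mulgA.
Qed.

Lemma polyact1 p : polyact 1%g p = p.
Proof.
rewrite -[RHS]comp_mpoly_id /polyact; congr comp_mpoly.
by apply: eq_mktuple => i; rewrite mul1g enum_valK.
Qed.

Lemma polyact_inj g : injective (polyact g).
Proof.
by apply: (@can_inj _ _ _ (polyact g^-1%g)) => p; rewrite polyactM mulVg polyact1.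
Qed.

Lemma polyact_eq0 g p : (polyact g p == 0) = (p == 0).
Proof. by rewrite -[RHS](inj_eq (@polyact_inj g)) rmorph0. Qed.

Lemma ratactE g p q : q != 0 ->
  ratact g (p%:F / q%:F) = (polyact g p)%:F / (polyact g q)%:F.
Proof.
move=> q0; rewrite /ratact; set f := p%:F / q%:F; set u := generic_quotient.repr f.
have d0 : \d_u != 0 by exact: denom_ratioP.
have tF (v : {mpoly K[#|gT|]}) : v != 0 -> v%:F != 0 by rewrite tofrac_eq0.
have /eqP := frac_numden f; rewrite -/u /f.
rewrite eqr_div ?tF // -!tofracM tofrac_eq => /eqP e.
apply/eqP; rewrite eqr_div ?tF ?polyact_eq0 // -!tofracM tofrac_eq.
by rewrite -!rmorphM /= e.
Qed.

Lemma ratact_poly g p : ratact g p%:F = (polyact g p)%:F.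
Proof.
by rewrite -[p%:F]divr1 -tofrac1 ratactE ?oner_neq0 // rmorph1 tofrac1 divr1.
Qed.

Lemma ratact_is_zmod_morphism g : zmod_morphism (ratact g).
Proof.
move=> x y; rewrite [x]frac_numden [y]frac_numden.
move: (generic_quotient.repr x) (generic_quotient.repr y) => u v.
have [du dv] : \d_u != 0 /\ \d_v != 0 by split; exact: denom_ratioP.
have tF (w : {mpoly K[#|gT|]}) : w != 0 -> w%:F \is a GRing.unit.
  by rewrite unitfE tofrac_eq0.
have -> : (\n_u)%:F / (\d_u)%:F - (\n_v)%:F / (\d_v)%:F
          = (\n_u * \d_v - \n_v * \d_u)%:F / (\d_u * \d_v)%:F.
  by rewrite -mulNr addf_div -?unitfE ?tF // -tofracN -!tofracM -tofracD mulNr.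
rewrite !ratactE ?mulf_neq0 // rmorphB !rmorphM /=.
rewrite -[in RHS]mulNr addf_div -?unitfE ?tF ?polyact_eq0 //.
by rewrite -tofracN -!tofracM -tofracD mulNr.
Qed.

HB.instance Definition _ g := GRing.isZmodMorphism.Build _ _ (ratact g)
  (ratact_is_zmod_morphism g).

Lemma ratact_is_monoid_morphism g : monoid_morphism (ratact g).
Proof.
split=> [|x y]; first by rewrite -tofrac1 ratact_poly rmorph1.
rewrite [x]frac_numden [y]frac_numden.
move: (generic_quotient.repr x) (generic_quotient.repr y) => u v.
have [du dv] : \d_u != 0 /\ \d_v != 0 by split; exact: denom_ratioP.
rewrite mulf_div -!tofracM !ratactE ?mulf_neq0 //.
by rewrite mulf_div -!tofracM !rmorphM.
Qed.

HB.instance Definition _ g := GRing.isMonoidMorphism.Build _ _ (ratact g)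
  (ratact_is_monoid_morphism g).

Lemma ratactC g c : ratact g (ratfunC _ c) = ratfunC _ c.
Proof. by rewrite ratact_poly polyactC. Qed.

Lemma ratactX g h : ratact g (xvar h) = xvar (g * h)%g.
Proof. by rewrite ratact_poly polyactX. Qed.

Lemma ratact1 f : ratact 1%g f = f.
Proof. by rewrite /ratact !polyact1 -frac_numden. Qed.

Lemma ratactM g h f : ratact g (ratact h f) = ratact (g * h)%g f.
Proof.
rewrite [f]frac_numden; move: (generic_quotient.repr f) => u.
have d0 : \d_u != 0 by exact: denom_ratioP.
by rewrite (ratactE h) // !ratactE ?polyact_eq0 // !polyactM.
Qed.

Definition invariants : {pred ratfun K #|gT|} :=
  fun f => [forall g, ratact g f == f].

Lemma invariantsP f :
  reflect (forall g, ratact g f = f) (f \in invariants).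
Proof. exact: 'forall_eqP. Qed.

Lemma invariants_divring_closed : divring_closed invariants.
Proof.
split=> [|x y /invariantsP xG /invariantsP yG|
          x y /invariantsP xG /invariantsP yG]; apply/invariantsP => g.
- by rewrite rmorph1.
- by rewrite rmorphB /= xG yG.
- by rewrite fmorph_div /= xG yG.
Qed.

HB.instance Definition _ := GRing.isDivringClosed.Build _ invariants
  invariants_divring_closed.

Definition fixed_field : fieldType := subfield_of invariants.

Lemma ratfunC_invariants c : ratfunC _ c \in invariants.
Proof. by apply/invariantsP => g; rewrite ratactC. Qed.

Definition fixed_fieldC (c : K) : fixed_field :=
  Subfield (ratfunC_invariants c).

Lemma fixed_fieldC_is_zmod_morphism : zmod_morphism fixed_fieldC.
Proof. by move=> c d; apply: val_inj; rewrite /= rmorphB. Qed.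

Lemma fixed_fieldC_is_monoid_morphism : monoid_morphism fixed_fieldC.
Proof.
by split=> [|c d]; apply: val_inj; rewrite /= ?rmorph1 ?rmorphM.
Qed.

HB.instance Definition _ := GRing.isZmodMorphism.Build K fixed_field
  fixed_fieldC fixed_fieldC_is_zmod_morphism.
HB.instance Definition _ := GRing.isMonoidMorphism.Build K fixed_field
  fixed_fieldC fixed_fieldC_is_monoid_morphism.

End RegularAction.

Arguments fixed_field : clear implicits.
Arguments fixed_fieldC : clear implicits.

(* Main.v *)
Require Import Defs.
From HB Require Import structures.
From mathcomp Require Import all_boot all_order all_fingroup all_algebra.
From mathcomp Require Import all_solvable all_character.
From mathcomp Require Import boolp mpoly ring.

(* Miyata's theorem: let a finite group act on L(y), with y transcendental over
   L, preserving L and sending y to a y + b with a <> 0 and b in L.  Then the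
   invariants are L^G(f), where f is an invariant polynomial of least positive
   degree in y.  So any tower of such extensions has rational invariants over
   the invariants of its base.

   In characteristic p a unitriangular basis of the regular representation of
   the p-group G gives such a tower over K.

   Otherwise put q = p^r.  Then G acts faithfully on the sum of two monomial
   representations with bases X_(s,t), s in {1, 2}, t in Z/q, that embed in the
   regular one.  The ratios u_(s,t) = X_(s,t+1) / X_(s,t) are permuted
   cyclically up to q-th roots of unity, so G multiplies each quotient w of two
   Fourier transforms of u_(s,.) by a scalar.  Since the product of the u_(s,t)
   over t is 1, the q-th power of u_(s,0) lies in K(w), and as beta_s fixes K(w)
   and multiplies u_(s,0) by a primitive q-th root of unity, K(u)^G = K(w)^G.
   Above K(u) come the two X_(s,0), which are scaled by K(u), and invariant
   forms supplied by Dedekind's independence of characters. *)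

Set Implicit Arguments.
Unset Strict Implicit.
Unset Printing Implicit Defensive.

Import GRing.Theory.
Local Open Scope ring_scope.

(** * Subfields, algebraic closure and transcendence *)

Section Subfields.

Variable F : fieldType.
Implicit Types (S T : divringClosed F) (x y : F) (ys : seq F) (p q : {poly F}).

(** The Fourier transforms of the [u_(s,t)] diagonalise the action, but the [u_(s,t)] have product 1
    over [t], so the transforms are algebraically dependent. Passing to quotients of transforms
    leaves q - 1 elements for each s, at the price of a q-th root to be extracted for each s.
    Miyata's theorem does not reach this algebraic step from K(w) to K(u); the Kummer argument takes
    its place. Algebraic independence in the towers is never checked by hand. A tower is built from
    at most |G| elements over which all |G| variables are algebraic, and Steinitz exchange forces
    such elements to be independent; in the monomial case the count is 2(q - 1) + 2 + (|G| - 2q).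
    The root of unity of order q^2 enters through beta_s, which has order q^2 and multiplies the
    basis vectors by scalars. G is known only by its presentation. The relations bound its order
    above by q^6, and the permutations realising the monomial representations bound it below by
    q^6. *)

Lemma polyOver_subfield S p : p \is a polyOver S ->
  exists p' : {poly subfield_of S}, p = map_poly val p'.
Proof.
move=> /polyOverP pS; exists (\poly_(i < size p) Subfield (pS i)).
apply/polyP => i; rewrite coef_map coef_poly /=.
by case: ltnP => [//|/leq_sizeP->]; rewrite ?rmorph0.
Qed.

Lemma polyOver_val S (p : {poly subfield_of S}) : map_poly val p \is a polyOver S.
Proof. by apply/polyOverP => i; rewrite coef_map /=; apply: valP. Qed.

(** Fields are predicates on the one ambient field [F]: a tower is then a chain of inclusions, and
    no embedding has to be carried along. *)
Definition adjoin S y : {pred F} := fun x =>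
  `[< exists p q, [/\ p \is a polyOver S, q \is a polyOver S,
                      q.[y] != 0 & x = p.[y] / q.[y]] >].

Lemma adjoinP S y x :
  reflect (exists p q, [/\ p \is a polyOver S, q \is a polyOver S,
                           q.[y] != 0 & x = p.[y] / q.[y]])
    (x \in adjoin S y).
Proof. exact: asboolP. Qed.

Lemma adjoin_divring_closed S y : divring_closed (adjoin S y).
Proof.
split=> [|_ _ /adjoinP[p [q [pS qS q0 ->]]] /adjoinP[p' [q' [pS' qS' q0' ->]]]|
  _ _ /adjoinP[p [q [pS qS q0 ->]]] /adjoinP[p' [q' [pS' qS' q0' ->]]]].
- by apply/adjoinP; exists 1, 1; rewrite rpred1 hornerC oner_neq0 divr1.
- apply/adjoinP; exists (p * q' - p' * q), (q * q').
  rewrite rpredB ?rpredM // !hornerE mulf_neq0 //; split=> //.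
  by rewrite -mulNr addf_div // mulNr.
- have [->|p0'] := eqVneq p'.[y] 0.
    rewrite mul0r invr0 mulr0; apply/adjoinP; exists 0, 1.
    by rewrite rpred0 rpred1 !hornerC oner_neq0 mul0r.
  apply/adjoinP; exists (p * q'), (q * p').
  by rewrite !rpredM // !hornerE mulf_neq0 // invf_div mulf_div.
Qed.

HB.instance Definition _ S y := GRing.isDivringClosed.Build F (adjoin S y)
  (adjoin_divring_closed S y).

Lemma adjoin_base S y : {subset S <= adjoin S y}.
Proof.
move=> x xS; apply/adjoinP; exists x%:P, 1.
by rewrite polyOverC xS rpred1 !hornerE oner_neq0 divr1.
Qed.

Lemma adjoin_gen S y : y \in adjoin S y.
Proof.
apply/adjoinP; exists 'X, 1.
by rewrite polyOverX rpred1 !hornerE oner_neq0 divr1.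
Qed.

Lemma adjoin_min S T y : {subset S <= T} -> y \in T -> {subset adjoin S y <= T}.
Proof.
move=> ST yT _ /adjoinP[p [q [pS qS _ ->]]].
by apply: rpred_div; apply: rpred_horner => //; apply: polyOverS ST _ _.
Qed.

Lemma adjoinS S T y : {subset S <= T} -> {subset adjoin S y <= adjoin T y}.
Proof.
move=> ST; apply: adjoin_min; last exact: adjoin_gen.
by move=> x /ST; apply: adjoin_base.
Qed.

Fixpoint gens S ys : divringClosed F :=
  if ys is y :: ys' then gens (adjoin S y) ys' else S.

Lemma gens_base S ys : {subset S <= gens S ys}.
Proof.
elim: ys S => [|y ys IH] S x xS //=; apply: IH; exact: adjoin_base.
Qed.

Lemma gens_gen S ys y : y \in ys -> y \in gens S ys.
Proof.
elim: ys S => [|z ys IH] S //=; rewrite inE => /predU1P[->|/IH//].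
by apply: gens_base; apply: adjoin_gen.
Qed.

Lemma gens_min S T ys : {subset S <= T} -> {subset ys <= T} ->
  {subset gens S ys <= T}.
Proof.
elim: ys S => [|y ys IH] S ST ysT //=; apply: IH => [|z zs].
  by apply: adjoin_min => //; apply: ysT; apply: mem_head.
by apply: ysT; rewrite inE zs orbT.
Qed.

Lemma gensS S T ys : {subset S <= T} -> {subset gens S ys <= gens T ys}.
Proof.
move=> ST; apply: gens_min => y; last exact: gens_gen.
by move=> /ST; apply: gens_base.
Qed.

Lemma gens_cat S ys zs : gens S (ys ++ zs) = gens (gens S ys) zs.
Proof. by elim: ys S => //=. Qed.

Definition algcl S : {pred F} :=
  fun x => `[< algebraicOver (val : subfield_of S -> F) x >].

Lemma algclP S x : reflect (algebraicOver (val : subfield_of S -> F) x)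
  (x \in algcl S).
Proof. exact: asboolP. Qed.

Lemma algcl_divring_closed S : divring_closed (algcl S).
Proof.
split=> [|x y /algclP xa /algclP ya|x y /algclP xa /algclP ya]; apply/algclP.
- exact: algebraic1.
- exact: algebraic_sub.
- exact: algebraic_div.
Qed.

HB.instance Definition _ S := GRing.isDivringClosed.Build F (algcl S)
  (algcl_divring_closed S).

Lemma algcl_polyP S x :
  reflect (exists p, [/\ p \is a polyOver S, p != 0 & root p x])
    (x \in algcl S).
Proof.
apply: (iffP (algclP S x)) => [[p p0 px]|[_ [/polyOver_subfield[p ->]]]].
  by exists (map_poly val p); rewrite polyOver_val map_poly_eq0.
by rewrite map_poly_eq0 => p0 px; exists p.
Qed.

Lemma algcl_base S : {subset S <= algcl S}.
Proof.
move=> x xS; apply/algcl_polyP; exists ('X - x%:P).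
by rewrite polyXsubC_eq0 root_XsubC polyOverXsubC.
Qed.

Lemma algclS S T : {subset S <= T} -> {subset algcl S <= algcl T}.
Proof.
move=> ST x /algcl_polyP[p [pS p0 px]]; apply/algcl_polyP; exists p.
by split=> //; apply: polyOverS ST _ _.
Qed.

Lemma algcl_idem S : {subset algcl (algcl S) <= algcl S}.
Proof.
move=> x /algcl_polyP[p [/polyOverP pS p0 px]]; apply/algclP/integral_algebraic.
apply: (@integral_root _ _ _ p x) => // _ /(nthP 0)[i ilt <-].
by apply/integral_algebraic/algclP/pS.
Qed.

Lemma algcl_min S T : {subset S <= algcl T} -> {subset algcl S <= algcl T}.
Proof. by move=> ST x /(algclS ST); apply: algcl_idem. Qed.

Lemma gens_algcl S ys : {subset gens (algcl S) ys <= algcl (gens S ys)}.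
Proof.
apply: gens_min; first by apply: algclS; apply: gens_base.
by move=> y ys_y; apply: algcl_base; apply: gens_gen.
Qed.

(** Clears the denominators of a polynomial over S(y), so that an equation satisfied by some [x] can
    be reread as one satisfied by [y]. *)
Lemma adjoin_common_denominator S y (c : nat -> F) n :
  (forall i, c i \in adjoin S y) ->
  exists (q : {poly F}) (a : nat -> {poly F}),
    [/\ q \is a polyOver S, q.[y] != 0, forall i, a i \is a polyOver S
      & forall i, (i < n)%N -> c i = (a i).[y] / q.[y]].
Proof.
move=> cS; elim: n => [|n [q [a [qS q0 aS cE]]]].
  exists 1, (fun=> 0); split=> //; rewrite ?rpred1 ?hornerC ?oner_neq0 //.
  by move=> i; apply: rpred0.
have /adjoinP[b [d [bS dS d0 bE]]] := cS n.
exists (q * d), (fun i => if i == n then b * q else a i * d).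
rewrite rpredM // hornerM mulf_neq0 //; split=> // i.
  by case: ifP => _; apply: rpredM.
rewrite ltnS leq_eqVlt; have [->|] := eqVneq i n => /= [_|_ /cE ->].
  by rewrite bE !hornerM [q.[y] * d.[y]]mulrC -mulf_div divff // mulr1.
by rewrite !hornerM -mulf_div divff // mulr1.
Qed.

(** Steinitz exchange. With denominators cleared, the equation of [x] reads sum_i x^i a_i(y) = 0
    with a_i in S[Y], which is an equation for [y] over S(x). It is not trivial: otherwise the
    coefficients of Y^k, for some [k] that occurs in the leading a_i, would make [x] algebraic over
    S. *)
Lemma algcl_exchange S x y :
  x \in algcl (adjoin S y) -> x \notin algcl S -> y \in algcl (adjoin S x).
Proof.
move=> /algcl_polyP[p [/polyOverP pS p0 px]] xS.
have [q [a [qS q0 aS pE]]] := adjoin_common_denominator (size p) pS.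
apply/algcl_polyP; exists (\sum_(i < size p) x ^+ i *: a i); split.
- apply: rpred_sum => i _; apply: polyOverZ; last first.
    by apply: polyOverS (aS i); apply: adjoin_base.
  by apply: rpredX; apply: adjoin_gen.
- have sp : ((size p).-1 < size p)%N by rewrite prednK // size_poly_gt0.
  have a_neq0 : a (size p).-1 != 0.
    apply: contraNneq p0 => a0; rewrite -lead_coef_eq0 lead_coefE.
    by rewrite pE // a0 horner0 mul0r.
  have [k ak] : exists k, (a (size p).-1)`_k != 0.
    by exists (size (a (size p).-1)).-1; rewrite -lead_coefE lead_coef_eq0.
  apply: contraNneq xS => /(congr1 (fun r : {poly F} => r`_k)).
  rewrite coef0 coef_sum => sum0; apply/algcl_polyP.
  exists (\poly_(i < size p) (a i)`_k); split.
  + by apply/polyOver_poly => i _; apply: (polyOverP (aS i)).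
  + apply: contraNneq ak => /(congr1 (fun r : {poly F} => r`_(size p).-1)).
    by rewrite coef_poly coef0 sp => ->.
  + apply/rootP; rewrite horner_poly -[RHS]sum0; apply: eq_bigr => i _.
    by rewrite coefZ mulrC.
- apply/rootP; rewrite horner_sum.
  rewrite (eq_bigr (fun i : 'I_(size p) => p`_i * x ^+ i * q.[y])).
    by rewrite -mulr_suml -horner_coef (rootP px) mul0r.
  by move=> i _; rewrite hornerZ pE // mulrAC divfK // mulrC.
Qed.

(** Algebraic independence over [S], stated one element at a time because Miyata's theorem climbs a
    tower one transcendental at a time. *)
Fixpoint chain S ys : Prop :=
  if ys is y :: ys' then y \notin algcl S /\ chain (adjoin S y) ys' else True.

Lemma chainW S T ys : {subset S <= algcl T} -> chain T ys -> chain S ys.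
Proof.
elim: ys S T => [//|y ys IH] S T ST /= [yT cT]; split.
  by apply: contra yT; apply: algcl_min.
apply: IH cT; apply: adjoin_min => [x /ST|].
  by apply: algclS; apply: adjoin_base.
by apply: algcl_base; apply: adjoin_gen.
Qed.

Lemma chain_cat S ys zs :
  chain S (ys ++ zs) <-> chain S ys /\ chain (gens S ys) zs.
Proof.
elim: ys S => [|y ys IH] S /=; first by split=> [|[]].
by split=> [[? /IH[]]|[[? ?] ?]]; split=> //; apply/IH.
Qed.

Lemma chain_drop S ys : ~ chain S ys ->
  exists2 zs, (size zs < size ys)%N & {subset gens S ys <= algcl (gens S zs)}.
Proof.
elim: ys S => [|y ys IH] S //= nch.
have [yS|yS] := boolP (y \in algcl S).
  exists ys => // x /(@gensS _ (algcl S)) h; apply: gens_algcl; apply: h.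
  by apply: adjoin_min => //; apply: algcl_base.
have [|zs szs zsP] := IH (adjoin S y); first by move=> ch; apply: nch.
by exists (y :: zs).
Qed.

(* The first [x] that becomes algebraic over [S(y)] is traded for [y]. *)
Lemma chain_exchange S xs y : chain S xs -> chain (adjoin S y) xs \/
  exists zs, [/\ size xs = (size zs).+1, {subset zs <= xs}
                & chain (adjoin S y) zs].
Proof.
elim: xs S => [|x xs IH] S /=; first by left.
move=> [xS chx]; have [xy|xy] := boolP (x \in algcl (adjoin S y)).
  right; exists xs; split=> // [z zxs|]; first by rewrite inE zxs orbT.
  apply: chainW chx; apply: adjoin_min; last exact: algcl_exchange.
  by move=> z zS; apply: algcl_base; apply: adjoin_base.
have swap : {subset adjoin (adjoin S y) x <= algcl (adjoin (adjoin S x) y)}.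
  move=> z zyx; apply: algcl_base; move: z zyx; apply: adjoin_min.
    by apply: adjoinS; apply: adjoin_base.
  by apply: adjoin_base; apply: adjoin_gen.
have [chxy|[zs [szs zsub chz]]] := IH _ chx.
  by left; split=> //; apply: chainW chxy.
right; exists (x :: zs); split=> /= [|z|]; first by rewrite szs.
  by rewrite !inE => /predU1P[->|/zsub->]; rewrite ?eqxx ?orbT.
by split=> //; apply: chainW chz.
Qed.

(** Induction on [ys]: by exchange, adjoining one element of [ys] to the base costs at most one
    element of [xs]. *)
Lemma chain_size S xs ys : chain S xs -> {subset xs <= algcl (gens S ys)} ->
  (size xs <= size ys)%N.
Proof.
elim: ys S xs => [|y ys IH] S [|x xs] // ch sub.
  by case: ch => /negP[]; apply: sub; apply: mem_head.
have [/IH|[zs [-> zsub /IH]]] := chain_exchange y ch; first by move/(_ sub)/leqW.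
by apply=> z /zsub /sub.
Qed.

(** A dependent list could be shortened up to algebraic closure, and would then be too short for
    [xs]. The towers built below get their independence from here, by counting generators. *)
Lemma generators_chain S xs ys : chain S xs -> (size ys <= size xs)%N ->
  {subset xs <= algcl (gens S ys)} -> chain S ys.
Proof.
move=> chx sz sub; apply: contrapT => /chain_drop[zs szs zsP].
suff: (size xs <= size zs)%N by rewrite leqNgt (leq_trans szs).
apply: chain_size chx _ => x /sub; exact: algcl_min.
Qed.

End Subfields.

(** * Miyata's theorem *)

Lemma polyOver_edivp (F : fieldType) (S : divringClosed F) (p d : {poly F}) :
  p \is a polyOver S -> d \is a polyOver S -> d != 0 ->
  exists q r : {poly F}, [/\ q \is a polyOver S, r \is a polyOver S,
    p = q * d + r & (size r < size d)%N].
Proof.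
move=> /polyOver_subfield[p' ->] /polyOver_subfield[d' ->].
rewrite map_poly_eq0 => d0.
exists (map_poly val (p' %/ d')), (map_poly val (p' %% d')).
split; rewrite ?polyOver_val // -?rmorphM -?rmorphD /= -?divp_eq //.
by rewrite !(size_map_poly (val : {rmorphism subfield_of S -> F})) ltn_modp.
Qed.

Section FixedSubfields.

Variables (F : fieldType) (gT : finGroupType) (act : gT -> {rmorphism F -> F}).
Hypothesis actM : forall g h x, act (g * h)%g x = act g (act h x).
Implicit Types (S T : divringClosed F) (x y : F) (ys : seq F) (p q : {poly F}).

Definition act_stable S := forall g x, x \in S -> act g x \in S.

Definition act_invariant x := [forall g, act g x == x].

Lemma act_invariantP x : reflect (forall g, act g x = x) (act_invariant x).
Proof. exact: 'forall_eqP. Qed.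

Definition fixed S : {pred F} := fun x => (x \in S) && act_invariant x.

Lemma fixed_divring_closed S : divring_closed (fixed S).
Proof.
split=> [|x y /andP[xS /act_invariantP xG] /andP[yS /act_invariantP yG]|
          x y /andP[xS /act_invariantP xG] /andP[yS /act_invariantP yG]];
  apply/andP; split; rewrite ?rpred1 ?rpredB ?rpred_div //; apply/act_invariantP => g.
- by rewrite rmorph1.
- by rewrite rmorphB /= xG yG.
- by rewrite fmorph_div /= xG yG.
Qed.

HB.instance Definition _ S := GRing.isDivringClosed.Build F (fixed S)
  (fixed_divring_closed S).

Lemma fixed_sub S : {subset fixed S <= S}.
Proof. by move=> x /andP[]. Qed.

Lemma fixed_id S : (forall g x, x \in S -> act g x = x) -> fixed S =i S.
Proof.
move=> Sid x; apply: andb_idr => xS.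
by apply/act_invariantP => g; apply: Sid.
Qed.

Lemma norm_invariant x : act_invariant (\prod_g act g x).
Proof.
apply/act_invariantP => h; rewrite rmorph_prod [RHS](reindex_inj (mulgI h)) /=.
by apply: eq_bigr => g _; rewrite actM.
Qed.

Definition affine_over S y := forall g, exists a b,
  [/\ a \in S, b \in S, a != 0 & act g y = a * y + b].

Lemma adjoin_stable S y : act_stable S -> affine_over S y -> act_stable (adjoin S y).
Proof.
move=> Sst aff g _ /adjoinP[p [q [pS qS _ ->]]].
have [a [b [aS bS _ yE]]] := aff g.
have gyS : act g y \in adjoin S y.
  by rewrite yE rpredD ?rpredM ?adjoin_gen //; apply: adjoin_base.
have gS (r : {poly F}) : r \is a polyOver S -> act g r.[y] \in adjoin S y.
  move=> /polyOverP rS; rewrite -horner_map; apply: rpred_horner => //.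
  by apply/polyOverP => i; rewrite coef_map; apply: adjoin_base; apply: Sst.
by rewrite fmorph_div rpred_div ?gS.
Qed.

Section Miyata.

Variables (S : divringClosed F) (y : F).
Hypotheses (Sst : act_stable S) (yS : y \notin algcl S) (aff : affine_over S y).

Lemma transcendental_inj p q : p \is a polyOver S -> q \is a polyOver S ->
  p.[y] = q.[y] -> p = q.
Proof.
move=> pS qS pq; apply/eqP; rewrite -subr_eq0; apply: contraNT yS => pq0.
apply/algcl_polyP; exists (p - q); rewrite rpredB // pq0.
by split=> //; apply/rootP; rewrite !hornerE pq subrr.
Qed.

(** Acting on the coefficients and substituting [a X + b] realises the action on polynomials in [y];
    the degree is kept because [a] is not zero. *)
Lemma act_horner g p : p \is a polyOver S ->
  exists p', [/\ p' \is a polyOver S, size p' = size p & act g p.[y] = p'.[y]].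
Proof.
move=> /polyOverP pS; have [a [b [aS bS a0 yE]]] := aff g.
exists (map_poly (act g) p \Po (a *: 'X + b%:P)); split.
- apply: polyOver_comp.
    by apply/polyOverP => i; rewrite coef_map; apply: Sst.
  by rewrite rpredD ?polyOverC ?polyOverZ ?polyOverX.
- rewrite size_comp_poly2 ?size_map_poly //.
  by rewrite size_addl size_scale ?size_polyX ?size_polyC //; case: eqP.
- by rewrite horner_comp !hornerE -yE horner_map.
Qed.

Lemma act_prod_horner (P : pred gT) p : p \is a polyOver S ->
  exists2 p', p' \is a polyOver S & \prod_(g | P g) act g p.[y] = p'.[y].
Proof.
move=> pS; elim/big_rec: _ => [|g _ _ [p' pS' ->]].
  by exists 1; rewrite ?rpred1 ?hornerC.
have [q [qS _ ->]] := act_horner g pS.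
by exists (q * p'); rewrite ?rpredM ?hornerM.
Qed.

(** The norm of [y] is a product of |G| polynomials of degree 1 in [y]. Size [n.+2] means degree n +
    1, so that the search for a minimum runs over all naturals. *)
Lemma invariant_horner_exists :
  exists n, `[< exists p, [/\ p \is a polyOver S, size p = n.+2
                            & act_invariant p.[y]] >].
Proof.
have XS : 'X \is a polyOver S by exact: polyOverX.
have [p pS pE] : exists2 p, p \is a polyOver S &
    (1 < size p)%N /\ \prod_g act g y = p.[y].
  have : (0 < #|gT|)%N by apply/card_gt0P; exists 1%g.
  rewrite cardT -[X in (0 < X)%N]/(size (enum gT)) -big_enum /=.
  elim: (enum gT) => // g s IH _; have [q [qS sq qE]] := act_horner g XS.
  rewrite hornerX in qE; case: s => [|h s] in IH *.
    by exists q => //; rewrite big_seq1 sq size_polyX.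
  have [//|p pS [sp pE]] := IH; exists (q * p); first exact: rpredM.
  rewrite big_cons qE pE hornerM; split=> //.
  by rewrite size_mul -?size_poly_gt0 ?sq ?size_polyX // ltnW.
case: pE => sp pE; exists (size p).-2; apply/asboolP; exists p; split=> //.
  by case: (size p) sp => [|[]].
by rewrite -pE norm_invariant.
Qed.

(** An invariant polynomial is divided by [d]: the remainder is an invariant of smaller degree than
    [d], hence constant, and the quotient is treated by induction. A fraction is reduced to
    polynomials by making its denominator a norm. *)
Theorem miyata : exists2 f, f \notin algcl S &
  fixed (adjoin S y) =i adjoin (fixed S) f.
Proof.
have [n /asboolP[d [dS sd dG]] minn] := ex_minnP invariant_horner_exists.
have d0 : d != 0 by rewrite -size_poly_gt0 sd.
exists d.[y] => [|x].
  apply: contra yS => fS; have: y \in algcl (adjoin S d.[y]).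
    apply/algcl_polyP; exists (d - d.[y]%:P); split.
    - rewrite rpredB ?polyOverC ?adjoin_gen //.
      by apply: polyOverS dS; apply: adjoin_base.
    - by rewrite -size_poly_gt0 size_addl ?sd // size_opp size_polyC; case: eqP.
    - by apply/rootP; rewrite !hornerE subrr.
  by apply: algcl_min => //; apply: adjoin_min => //; apply: algcl_base.
set f := d.[y] in dG *; have fG := act_invariantP _ dG.
have poly_case p : p \is a polyOver S -> act_invariant p.[y] ->
    p.[y] \in adjoin (fixed S) f.
  have [m] := ubnP (size p); elim: m p => // m IH p.
  rewrite ltnS => sp pS /act_invariantP pG.
  have [q [r [qS rS pE sr]]] := polyOver_edivp pS dS d0.
  (* The images of quotient and remainder under [g] give a second division of [p] by [d]. It is an
     identity of polynomials because [y] is transcendental, so the two divisions agree. *)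
  have inv_qr g : act g q.[y] = q.[y] /\ act g r.[y] = r.[y].
    have [q' [qS' sq' qE']] := act_horner g qS.
    have [r' [rS' sr' rE']] := act_horner g rS.
    have pE' : p = q' * d + r'.
      apply: transcendental_inj; rewrite ?rpredD ?rpredM //.
      by rewrite -[LHS](pG g) [in LHS]pE !hornerE rmorphD rmorphM /= qE' rE' fG.
    have e : (q - q') * d = r' - r.
      by apply/eqP; rewrite mulrBl subr_eq addrAC eq_sym subr_eq addrC -pE' pE addrC.
    have qq' : q = q'.
      apply/eqP; rewrite -subr_eq0; apply/negPn/negP; rewrite -size_poly_gt0 => qq0.
      suff: (size d < size d)%N by rewrite ltnn.
      apply: leq_ltn_trans (leq_addl (size (q - q')%R).-1 _) _.
      have -> : ((size (q - q')%R).-1 + size d = (size (q - q')%R + size d).-1)%N.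
        by rewrite -[in RHS](prednK qq0).
      rewrite -size_mul // -?size_poly_gt0 // e.
      by rewrite (leq_ltn_trans (size_polyD _ _)) // size_polyN gtn_max sr' sr.
    split; first by rewrite qE' -qq'.
    have /eqP := e; rewrite qq' subrr mul0r eq_sym subr_eq0 => /eqP rr.
    by rewrite rE' rr.
  have qG : act_invariant q.[y] by apply/act_invariantP => g; case: (inv_qr g).
  have rG : act_invariant r.[y] by apply/act_invariantP => g; case: (inv_qr g).
  have r_const : r.[y] \in adjoin (fixed S) f.
    apply: adjoin_base; apply/andP; split=> //.
    suff /size1_polyC-> : (size r <= 1)%N by rewrite hornerC (polyOverP rS).
    rewrite leqNgt; apply: contraL sr => r_gt1; rewrite -leqNgt sd.
    have sr2 : size r = (size r).-2.+2 by case: (size r) r_gt1 => [|[]].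
    by rewrite sr2 !ltnS minn //; apply/asboolP; exists r.
  rewrite pE !hornerE rpredD // rpredM ?adjoin_gen //.
  have [->|q0] := eqVneq q 0; first by rewrite horner0 rpred0.
  apply: IH => //; apply: leq_trans sp; rewrite pE size_addl.
    rewrite size_mul // sd -[X in (_ < X)%N]/((_ + _.+1).-1) addnS /=.
    by rewrite addnS ltnS leq_addr.
  by rewrite size_mul // (leq_trans sr) // -subn1 -addnBAC ?size_poly_gt0 // leq_addl.
apply/idP/idP => [/andP[/adjoinP[p [q [pS qS q0 ->]]] xG]|].
  pose N' := \prod_(g | g != 1%g) act g q.[y].
  have NE : \prod_g act g q.[y] = q.[y] * N'.
    rewrite (bigD1 1%g) //=; congr (_ * _).
    (* [act 1] is idempotent by [actM] and injective, hence the identity. *)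
    by apply: (fmorph_inj (act 1%g)); rewrite -actM mulg1.
  have N0 : q.[y] * N' != 0.
    by rewrite -NE; apply/prodf_neq0 => g _; rewrite fmorph_eq0.
  have [m mS N'E] := act_prod_horner (fun g => g != 1%g) qS.
  have NG : act_invariant (q * m).[y] by rewrite hornerM -N'E -NE norm_invariant.
  have xE : p.[y] / q.[y] = (p * m).[y] / (q * m).[y].
    rewrite !hornerM -mulf_div divff ?mulr1 // -N'E.
    by apply: contraNneq N0; rewrite /N' => ->; rewrite mulr0.
  rewrite xE; apply: rpred_div; apply: poly_case; rewrite ?rpredM //.
  apply/act_invariantP => g; have /act_invariantP/(_ g) := xG; rewrite xE fmorph_div /=.
  rewrite (act_invariantP _ NG) => /(mulIf _)->//.
  by rewrite invr_eq0 hornerM -N'E.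
apply: adjoin_min x => [x /andP[xS xG]|].
  by apply/andP; split=> //; apply: adjoin_base.
apply/andP; split=> //; apply: rpred_horner; last exact: adjoin_gen.
by apply: polyOverS dS; apply: adjoin_base.
Qed.

End Miyata.

Fixpoint affine_chain S ys : Prop :=
  if ys is y :: ys' then affine_over S y /\ affine_chain (adjoin S y) ys'
  else True.

Lemma gens_stable S ys : act_stable S -> affine_chain S ys -> act_stable (gens S ys).
Proof.
elim: ys S => [//|y ys IH] S Sst [aff affs] /=.
by apply: IH affs; apply: adjoin_stable.
Qed.

Theorem miyata_chain S ys : act_stable S -> chain S ys -> affine_chain S ys ->
  exists2 fs, chain (fixed S) fs & fixed (gens S ys) =i gens (fixed S) fs.
Proof.
elim: ys S => [|y ys IH] S Sst /=; first by exists [::].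
move=> [yS chy] [aff affs].
have [f fS fE] := miyata Sst yS aff.
have [fs chf fsE] := IH _ (adjoin_stable Sst aff) chy affs.
exists (f :: fs) => /=.
  split; first by apply: contra fS; apply: algclS; apply: fixed_sub.
  by apply: chainW chf => x; rewrite -fE; apply: algcl_base.
by move=> x; rewrite fsE; apply/idP/idP; apply: gensS => z; rewrite fE.
Qed.

End FixedSubfields.

(** * Rational function fields *)

Section FracLift.

Variables (R : idomainType) (F : fieldType) (h : {rmorphism R -> F}).
Hypothesis h_inj : injective h.

Definition fraclift (x : {fraction R}) : F :=
  let u := generic_quotient.repr x in h \n_u / h \d_u.

Lemma fraclift_neq0 x : x != 0 -> h x != 0.
Proof. by move=> x0; rewrite -(inj_eq h_inj) rmorph0 in x0. Qed.

Lemma fracliftE p q : q != 0 -> fraclift (p%:F / q%:F) = h p / h q.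
Proof.
move=> q0; rewrite /fraclift; set f := p%:F / q%:F; set u := generic_quotient.repr f.
have d0 : \d_u != 0 by exact: denom_ratioP.
have tF (v : R) : v != 0 -> v%:F != 0 by rewrite tofrac_eq0.
have /eqP := frac_numden f; rewrite -/u /f.
rewrite eqr_div ?tF // -!tofracM tofrac_eq => /eqP e.
by apply/eqP; rewrite eqr_div ?fraclift_neq0 // -!rmorphM /= e.
Qed.

Lemma fraclift_tofrac p : fraclift p%:F = h p.
Proof. by rewrite -[p%:F]divr1 -tofrac1 fracliftE ?oner_neq0 // rmorph1 divr1. Qed.

Lemma fraclift_zmod_morphism : zmod_morphism fraclift.
Proof.
move=> x y; rewrite [x]frac_numden [y]frac_numden.
move: (generic_quotient.repr x) (generic_quotient.repr y) => u v.
have [du dv] : \d_u != 0 /\ \d_v != 0 by split; exact: denom_ratioP.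
rewrite -mulNr addf_div ?tofrac_eq0 // -tofracN -!tofracM -tofracD.
rewrite !fracliftE ?mulf_neq0 // -[in RHS]mulNr addf_div ?fraclift_neq0 //.
by rewrite rmorphD !rmorphM rmorphN.
Qed.

Lemma fraclift_monoid_morphism : monoid_morphism fraclift.
Proof.
split=> [|x y]; first by rewrite -tofrac1 fraclift_tofrac rmorph1.
rewrite [x]frac_numden [y]frac_numden.
move: (generic_quotient.repr x) (generic_quotient.repr y) => u v.
have [du dv] : \d_u != 0 /\ \d_v != 0 by split; exact: denom_ratioP.
by rewrite mulf_div -!tofracM !fracliftE ?mulf_neq0 // mulf_div !rmorphM.
Qed.

Definition fraclift_rmorphism : {rmorphism {fraction R} -> F} :=
  HB.pack fraclift
    (GRing.isZmodMorphism.Build _ _ fraclift fraclift_zmod_morphism)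
    (GRing.isMonoidMorphism.Build _ _ fraclift fraclift_monoid_morphism).

End FracLift.

Lemma mmap_muni (n : nat) (R S : comNzRingType) (f : {rmorphism R -> S})
    (h : 'I_n.+1 -> S) (p : {mpoly R[n.+1]}) :
  mmap f h p =
    (map_poly (mmap f (fun i => h (widen_ord (leqnSn n) i))) (muni p)).[h ord_max].
Proof.
rewrite muniE raddf_sum /= horner_sum [LHS]/mmap; apply: eq_bigr => m _.
rewrite map_polyZ map_polyXn hornerZ hornerXn /= mmapZ mmapX /=.
rewrite /mmap1 big_ord_recr /= mulrA; congr (_ * _ * _).
by apply: eq_bigr => i _; rewrite mnmE.
Qed.

(** By [mmap_muni], evaluation at the variables themselves, which is the identity, factors through
    [muni]. *)
Lemma muni_inj (n : nat) (R : comNzRingType) : injective (@muni n R).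
Proof.
move=> p q pq.
have idE (r : {mpoly R[n.+1]}) : r = mmap (@mpolyC _ _) (fun i => 'X_i) r.
  rewrite {1}[r]mpolyE; apply: eq_bigr => m _.
  by rewrite mmap1_id mul_mpolyC.
by rewrite [p]idE [q]idE !mmap_muni pq.
Qed.

Section Base.

Variables (K F : fieldType) (iota : {rmorphism K -> F}).

Definition base : {pred F} := fun x => `[< exists c, x = iota c >].

Lemma baseP x : reflect (exists c, x = iota c) (x \in base).
Proof. exact: asboolP. Qed.

Lemma base_divring_closed : divring_closed base.
Proof.
split=> [|_ _ /baseP[c ->] /baseP[d ->]|_ _ /baseP[c ->] /baseP[d ->]];
  apply/baseP.
- by exists 1; rewrite rmorph1.
- by exists (c - d); rewrite rmorphB.
- by exists (c / d); rewrite fmorph_div.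
Qed.

HB.instance Definition _ := GRing.isDivringClosed.Build F base
  base_divring_closed.

Lemma mem_base c : iota c \in base.
Proof. by apply/baseP; exists c. Qed.

End Base.

Section Rationality.

Variables (K F : fieldType) (iota : {rmorphism K -> F}).

Lemma chain_rcons (S : divringClosed F) ys y :
  chain S (rcons ys y) -> chain S ys /\ y \notin algcl (gens S ys).
Proof. by rewrite -cats1 => /chain_cat[? [? _]]. Qed.

Lemma mmap_gens m (h : 'I_m -> F) p : mmap iota h p \in gens (base iota) (codom h).
Proof.
rewrite /mmap; apply: rpred_sum => u _; apply: rpredM.
  by apply: gens_base; apply: mem_base.
by apply: rpred_prod => i _; apply: rpredX; apply: gens_gen; apply: codom_f.
Qed.

(** Induction on the number of variables. A polynomial killed by the evaluation is, in its last
    variable, an equation for [h ord_max] over the field of the other values; by transcendence its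
    coefficients evaluate to 0, and by induction they are 0. *)
Lemma chain_mmap_inj m (h : 'I_m -> F) : chain (base iota) (codom h) ->
  injective (mmap iota h).
Proof.
move=> ch; apply: raddf_inj => p; elim: m h ch p => [|m IH] h ch p.
  have -> : p = (p@_0%MM)%:MP.
    apply/mpolyP => u; rewrite mcoeffC; have -> : u = 0%MM by apply/mnmP => -[].
    by rewrite eqxx mulr1.
  by rewrite /= mmapC => /eqP; rewrite fmorph_eq0 => /eqP->; rewrite mpolyC0.
have codomE : codom h =
    rcons (codom (fun i => h (widen_ord (leqnSn m) i))) (h ord_max).
  rewrite /codom /image_mem enum_ordSr map_rcons -map_comp.
  by congr (rcons _ _); apply: eq_map => i /=; congr h; apply: val_inj.
move: ch; rewrite codomE => /chain_rcons[/IH{}IH hmax].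
rewrite /= mmap_muni => e; apply: muni_inj; rewrite raddf0; apply/eqP.
apply: contraNT hmax => p0; apply/algcl_polyP.
eexists; split; last by apply/rootP; exact: e.
  by apply/polyOverP => i; rewrite coef_map; apply: mmap_gens.
apply: contra_neq p0 => /polyP e0; apply/polyP => i; rewrite coef0; apply: IH.
by have := e0 i; rewrite coef_map coef0.
Qed.

Theorem chain_rational (T : divringClosed F)
    (iotaT : {rmorphism K -> subfield_of T}) fs :
  (forall c, val (iotaT c) = iota c) ->
  chain (base iota) fs -> T =i gens (base iota) fs ->
  rational_over iotaT.
Proof.
move=> iotaE ch TE; pose h (i : 'I_(size fs)) := fs`_i.
have codomE : codom h = fs.
  rewrite /codom /image_mem -[RHS](mkseq_nth 0) /mkseq -val_enum_ord -map_comp.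
  exact: eq_map.
have {}TE : T =i gens (base iota) (codom h) by move=> z; rewrite codomE.
have {}ch : chain (base iota) (codom h) by rewrite codomE.
have hinj := chain_mmap_inj ch.
pose phi := fraclift_rmorphism hinj.
have phiE p : phi p%:F = mmap iota h p by apply: fraclift_tofrac.
have phiT x : phi x \in T.
  by rewrite TE [x]frac_numden fmorph_div !phiE rpred_div ?mmap_gens.
pose psi x : subfield_of T := Subfield (phiT x).
have psi_add : zmod_morphism psi.
  by move=> x y; apply: val_inj; apply: (rmorphB phi).
have psi_mul : monoid_morphism psi.
  by split=> [|x y]; apply: val_inj; [apply: (rmorph1 phi)|apply: (rmorphM phi)].
pose psiR : {rmorphism ratfun K (size fs) -> subfield_of T} :=
  HB.pack psi (GRing.isZmodMorphism.Build _ _ psi psi_add)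
    (GRing.isMonoidMorphism.Build _ _ psi psi_mul).
exists (size fs), psiR; split.
  have surj x : exists y, psiR y == x.
    have: val x \in base phi.
      have := valP x; rewrite TE; apply: gens_min => [_ /baseP[c ->]|].
        by apply/baseP; exists (c%:MP%:F); rewrite phiE mmapC.
      move=> _ /codomP[i ->]; apply/baseP; exists ('X_i)%:F.
      by rewrite phiE mmapX mmap1U.
    by move=> /baseP[y yE]; exists y; apply/eqP/val_inj.
  exists (fun x => xchoose (surj x)) => [y|x]; last exact/eqP/(xchooseP (surj x)).
  exact/(fmorph_inj psiR)/eqP/(xchooseP (surj (psiR y))).
move=> c; apply: val_inj; rewrite iotaE -(mmapC h iota).
exact: (phiE c%:MP).
Qed.

End Rationality.

Lemma mpoly_rmorph_ext (K R : comNzRingType) (n : nat)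
    (f g : {rmorphism {mpoly K[n]} -> R}) :
  (forall c, f c%:MP = g c%:MP) -> (forall i, f 'X_i = g 'X_i) -> f =1 g.
Proof.
move=> fgC fgX p; rewrite [p]mpolyE !rmorph_sum; apply: eq_bigr => m _.
rewrite -mul_mpolyC !rmorphM fgC mpolyXE_id !rmorph_prod; congr (_ * _).
by apply: eq_bigr => i _; rewrite !rmorphXn fgX.
Qed.

Section Variables.

Variables (K : fieldType) (n : nat) (F : fieldType).
Variable emb : {rmorphism {mpoly K[n]} -> F}.
Hypothesis emb_inj : injective emb.
Implicit Types (J : {pred 'I_n}) (p q : {mpoly K[n]}).

(** A retraction onto the polynomials in the variables of [J]; being a ring morphism, it makes its
    fixed polynomials a subring at once. *)
Definition kill J : {rmorphism {mpoly K[n]} -> {mpoly K[n]}} :=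
  comp_mpoly [tuple if i \in J then 'X_i else 0 | i < n].

Lemma killX J i : kill J 'X_i = if i \in J then 'X_i else 0.
Proof. by rewrite /= comp_mpolyXU -tnth_nth tnth_mktuple. Qed.

Lemma killC J c : kill J c%:MP = c%:MP.
Proof. exact: comp_mpolyC. Qed.

(* [kill J p = p] says that only the variables numbered in [J] occur in [p]. *)
Definition ratvars J : {pred F} := fun x =>
  `[< exists p q, [/\ kill J p = p, kill J q = q, emb q != 0 & x = emb p / emb q] >].

Lemma ratvarsP J x :
  reflect (exists p q, [/\ kill J p = p, kill J q = q, emb q != 0 & x = emb p / emb q])
    (x \in ratvars J).
Proof. exact: asboolP. Qed.

Lemma ratvars_divring_closed J : divring_closed (ratvars J).
Proof.
split=> [|_ _ /ratvarsP[p [q [pJ qJ q0 ->]]] /ratvarsP[p' [q' [pJ' qJ' q0' ->]]]|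
  _ _ /ratvarsP[p [q [pJ qJ q0 ->]]] /ratvarsP[p' [q' [pJ' qJ' q0' ->]]]].
- by apply/ratvarsP; exists 1, 1; rewrite !rmorph1 oner_neq0 divr1.
- apply/ratvarsP; exists (p * q' - p' * q), (q * q').
  rewrite !rmorphB !rmorphM pJ qJ pJ' qJ' mulf_neq0 //; split=> //.
  by rewrite -[in LHS]mulNr addf_div // mulNr.
- have [->|p0'] := eqVneq (emb p') 0.
    rewrite mul0r invr0 mulr0; apply/ratvarsP; exists 0, 1.
    by rewrite !rmorph0 !rmorph1 oner_neq0 mul0r.
  apply/ratvarsP; exists (p * q'), (q * p').
  by rewrite !rmorphM pJ qJ pJ' qJ' mulf_neq0 // invf_div mulf_div.
Qed.

HB.instance Definition _ J := GRing.isDivringClosed.Build F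
  (ratvars J) (ratvars_divring_closed J).

Lemma ratvars_common_denominator J (c : nat -> F) m :
  (forall i, c i \in ratvars J) ->
  exists q (a : nat -> {mpoly K[n]}), [/\ emb q != 0, forall i, kill J (a i) = a i
      & forall i, (i < m)%N -> c i = emb (a i) / emb q].
Proof.
move=> cJ; suff [q [a [_ ? ? ?]]] : exists q (a : nat -> {mpoly K[n]}),
    [/\ kill J q = q, emb q != 0, forall i, kill J (a i) = a i
      & forall i, (i < m)%N -> c i = emb (a i) / emb q] by exists q, a.
elim: m => [|m [q [a [qJ q0 aJ cE]]]].
  by exists 1, (fun=> 0); rewrite !rmorph1 oner_neq0; split=> // i; rewrite rmorph0.
have /ratvarsP[b [d [bJ dJ d0 bE]]] := cJ m.
exists (q * d), (fun i => if i == m then b * q else a i * d).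
rewrite !rmorphM qJ dJ mulf_neq0 //; split=> // i.
  by case: ifP => _; rewrite rmorphM ?bJ ?qJ ?aJ ?dJ.
rewrite ltnS leq_eqVlt; have [->|] := eqVneq i m => /= [_|_ /cE ->].
  by rewrite bE !rmorphM [emb q * emb d]mulrC -mulf_div divff ?mulr1.
by rewrite !rmorphM -mulf_div divff ?mulr1.
Qed.

Lemma var_transcendental J i : i \notin J -> emb 'X_i \notin algcl (ratvars J).
Proof.
move=> iJ; apply/negP => /algcl_polyP[P [/polyOverP PJ P0 Pi]].
have [q [a [q0 aJ aE]]] := ratvars_common_denominator (size P) PJ.
have sum0 : \sum_(j < size P) a j * 'X_i ^+ j = 0.
  apply: emb_inj; rewrite rmorph_sum rmorph0.
  rewrite (eq_bigr (fun j : 'I_(size P) => emb q * (P`_j * emb 'X_i ^+ j))).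
    by rewrite -mulr_sumr -horner_coef (rootP Pi) mulr0.
  move=> j _; rewrite aE // rmorphM rmorphXn mulrA [emb q * _]mulrC divfK //.
(* [ev] keeps the variables of [J] as constants and turns [X_i] into the indeterminate, so that the
   relation [sum0] makes every coefficient [a j] vanish. *)
pose ev : {rmorphism {mpoly K[n]} -> {poly {mpoly K[n]}}} :=
  mmap (polyC \o @mpolyC n K)
    (fun k => if k \in J then ('X_k)%:P else if k == i then 'X else 0).
have evX k : ev 'X_k = if k \in J then ('X_k)%:P else if k == i then 'X else 0.
  by rewrite /= mmapX mmap1U.
have evJ p : kill J p = p -> ev p = p%:P.
  move=> pJ; rewrite -{1 2}pJ; move: p {pJ}.
  apply: (mpoly_rmorph_ext (f := ev \o kill J) (g := polyC \o kill J)).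
    by move=> c; rewrite /= killC mmapC.
  move=> k; rewrite -[LHS]/(ev (kill J 'X_k)) -[RHS]/((kill J 'X_k)%:P) !killX.
  by case: ifP => kJ; rewrite ?rmorph0 ?evX ?kJ.
have: ev 0 = \poly_(j < size P) a j.
  rewrite -sum0 rmorph_sum poly_def; apply: eq_bigr => j _.
  by rewrite rmorphM rmorphXn evJ // evX (negPf iJ) eqxx mul_polyC.
rewrite rmorph0 => /(congr1 (fun p : {poly _} => p`_(size P).-1)).
have sP : ((size P).-1 < size P)%N by rewrite prednK // size_poly_gt0.
rewrite coef0 coef_poly sP => a0; case/eqP: P0; apply/eqP.
by rewrite -lead_coef_eq0 lead_coefE aE // -a0 rmorph0 mul0r.
Qed.

Lemma ratvarsS J J' : {subset J <= J'} -> {subset ratvars J <= ratvars J'}.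
Proof.
move=> JJ' _ /ratvarsP[p [q [pJ qJ q0 ->]]]; apply/ratvarsP; exists p, q.
suff JK (r : {mpoly K[n]}) : kill J r = r -> kill J' r = r.
  by split=> [||//|//]; apply: JK.
move=> rJ; rewrite -{1 2}rJ; move: r {rJ}.
apply: (mpoly_rmorph_ext (f := kill J' \o kill J)) => [c|i].
  by rewrite /= !comp_mpolyC.
rewrite -[LHS]/(kill J' (kill J 'X_i)) !killX.
by case: ifP => iJ; rewrite ?rmorph0 // killX JJ'.
Qed.

Lemma chain_vars_ratvars (S : divringClosed F) J (s : seq 'I_n) :
  {subset S <= ratvars J} -> uniq s -> (forall i, i \in s -> i \notin J) ->
  chain S [seq emb 'X_i | i <- s].
Proof.
elim: s S J => [//|i s IH] S J SJ /= /andP[iNs us] sJ; split.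
  have iJ := var_transcendental (sJ i (mem_head _ _)).
  by apply: contra iJ; apply: algclS.
apply: (IH _ (predU1 i (mem J))) us _ => [|j js]; last first.
  rewrite !inE negb_or sJ ?inE ?js ?orbT // andbT.
  by apply: contraNneq iNs => <-.
apply: adjoin_min => [x /SJ|].
  by apply: ratvarsS => j jJ; rewrite inE /= jJ orbT.
apply/ratvarsP; exists 'X_i, 1; rewrite killX !inE eqxx !rmorph1 oner_neq0.
by rewrite divr1.
Qed.

End Variables.

Section RatfunVariables.

Variables (K : fieldType) (n : nat).

Lemma chain_vars (s : seq 'I_n) : uniq s ->
  chain (base (@ratfunC K n)) [seq ('X_i)%:F | i <- s].
Proof.
move=> us; have tofrac_inj : injective (@FracField.tofrac {mpoly K[n]}).
  by move=> p q /eqP; rewrite tofrac_eq => /eqP.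
apply: (chain_vars_ratvars tofrac_inj (J := pred0)) => // _ /baseP[c ->].
apply/ratvarsP; exists c%:MP, 1; rewrite killC; split; rewrite ?rmorph1 ?oner_neq0 //.
by rewrite divr1.
Qed.

Lemma gens_vars x :
  x \in gens (base (@ratfunC K n)) [seq ('X_i)%:F | i <- enum 'I_n].
Proof.
set T := gens _ _.
have polyT p : p%:F \in T.
  rewrite [p]mpolyE rmorph_sum; apply: rpred_sum => m _.
  rewrite -mul_mpolyC rmorphM; apply: rpredM.
    by apply: gens_base; apply/baseP; exists p@_m.
  rewrite mpolyXE_id rmorph_prod; apply: rpred_prod => i _.
  rewrite rmorphXn; apply: rpredX; apply: gens_gen.
  by apply/mapP; exists i; rewrite ?mem_enum.
by rewrite [x]frac_numden rpred_div.
Qed.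

End RatfunVariables.

(** * Kummer extensions and independence of characters *)

Lemma rpred_det (F : fieldType) (S : divringClosed F) m (A : 'M[F]_m) :
  (forall i j, A i j \in S) -> \det A \in S.
Proof.
move=> AS; apply: rpred_sum => s _; apply: rpredM.
  by rewrite rpredX ?rpredN ?rpred1.
by apply: rpred_prod => i _; apply: AS.
Qed.

Lemma rpred_invmx (F : fieldType) (S : divringClosed F) m (A : 'M[F]_m) i j :
  (forall i j, A i j \in S) -> invmx A i j \in S.
Proof.
move=> AS; rewrite /invmx; case: ifP => // _; rewrite !mxE.
rewrite rpredM ?rpredV ?rpred_det // /cofactor rpredM ?rpredX ?rpredN ?rpred1 //.
by apply: rpred_det => k l; rewrite !mxE.
Qed.

Section Completion.

Variables (F : fieldType) (n : nat) (P : 'rV[F]_n -> Prop).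
Hypothesis Pspan : forall c : 'cV[F]_n, (forall v, P v -> v *m c = 0) -> c = 0.

Definition spanmx (s : seq 'rV[F]_n) : 'M[F]_n := (\sum_(v <- s) <<v>>)%MS.

Lemma spanmx_sub s v : v \in s -> (v <= spanmx s)%MS.
Proof.
rewrite /spanmx; elim: s => // w s IH; rewrite inE big_cons => /predU1P[->|/IH vs].
  by apply: submx_trans (addsmxSl _ _); rewrite genmxE.
exact: submx_trans vs (addsmxSr _ _).
Qed.

(** [Pspan] is spanning in dual form. If the span of [s] is proper, its cokernel has a non-zero
    column; some [v] with [P v] does not annihilate it, so [v] lies outside the span and can be
    appended. *)
Lemma complete_basis (s : seq 'rV[F]_n) : \rank (spanmx s) = size s ->
  exists2 r, (forall v, v \in r -> P v)
    & size (s ++ r) = n /\ \rank (spanmx (s ++ r)) = n.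
Proof.
have [m] := ubnP (n - size s); elim: m s => // m IH s sm rs.
have := rank_leq_row (spanmx s); rewrite rs leq_eqVlt => /predU1P[sn|sn].
  by exists [::]; rewrite ?cats0 ?rs.
have [v Pv vs] : exists2 v, P v & ~~ (v <= spanmx s)%MS.
  apply: contrapT => no_v; have := sn; rewrite -rs -subn_gt0 -mxrank_coker.
  suff -> : cokermx (spanmx s) = 0 by rewrite mxrank0.
  apply: trmx_inj; apply/row_matrixP => i; rewrite trmx0 row0 -tr_col.
  rewrite (@Pspan (col i _)) ?trmx0 // => v Pv; rewrite colE mulmxA.
  have [vs|vs] := boolP (v <= spanmx s)%MS; last by case: no_v; exists v.
  by move: vs; rewrite submxE => /eqP ->; rewrite mul0mx.
have rE : spanmx (rcons s v) = (spanmx s + <<v>>)%MS.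
  by rewrite /spanmx -cats1 big_cat big_seq1.
have [||r rP [sr rr]] := IH (rcons s v).
- rewrite size_rcons subnS; move: sm; rewrite ltnS => sm.
  by rewrite prednK ?subn_gt0.
- apply/eqP; rewrite size_rcons rE eqn_leq; apply/andP; split.
    have [le_rank _] := mxrank_adds_leqif (spanmx s) <<v>>%MS.
    rewrite (leq_trans le_rank) // rs -(addn1 (size s)) leq_add2l.
    by rewrite mxrank_gen rank_leq_row.
  have: (spanmx s < spanmx s + <<v>>)%MS.
    by rewrite ltmxE addsmxSl addsmx_sub submx_refl genmxE.
  by rewrite ltmxErank rs => /andP[].
exists (v :: r); last by rewrite -cat_rcons.
by move=> w; rewrite inE => /predU1P[->|/rP].
Qed.

End Completion.

Section FixedPoints.

Variables (F : fieldType) (s : {rmorphism F -> F}).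

(** Made a subfield so that [gens_min] and [adjoin_min] reduce the triviality of an automorphism on
    a field to its generators. *)
Definition fixpoints : {pred F} := fun x => s x == x.

Lemma fixpoints_divring_closed : divring_closed fixpoints.
Proof.
split=> [|x y /eqP xs /eqP ys|x y /eqP xs /eqP ys]; apply/eqP.
- exact: rmorph1.
- by rewrite rmorphB xs ys.
- by rewrite fmorph_div xs ys.
Qed.

HB.instance Definition _ := GRing.isDivringClosed.Build F fixpoints
  fixpoints_divring_closed.

End FixedPoints.

(* An element of M(u) fixed by the Kummer automorphism s is the average of its
   conjugates, and averaging keeps only the powers of u lying in M. *)
Section Kummer.

Variables (F : fieldType) (M : divringClosed F) (u eta : F) (q : nat).
Variable s : {rmorphism F -> F}.
Hypotheses (eta_prim : q.-primitive_root eta) (qF : q%:R != 0 :> F).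
Hypotheses (etaM : eta \in M) (uM : u ^+ q \in M).
Hypotheses (sM : forall x, x \in M -> s x = x) (su : s u = eta * u).

Lemma kummer_poly (p : {poly F}) : p \is a polyOver M -> s p.[u] = p.[u] ->
  p.[u] \in M.
Proof.
move=> /polyOverP pM sp.
have iter_s k : p.[eta ^+ k * u] = p.[u].
  elim: k => [|k IH]; first by rewrite mul1r.
  rewrite -[RHS]sp -[in RHS]IH -horner_map rmorphM rmorphXn (sM etaM) su.
  rewrite mulrA -exprSr; congr horner.
  by apply/polyP => i; rewrite coef_map /= sM.
have : \sum_(k < q) p.[eta ^+ k * u] = q%:R * p.[u].
  by under eq_bigr do rewrite iter_s; rewrite sumr_const card_ord mulr_natl.
move=> /esym/(canRL (mulKf qF)) ->; rewrite rpredM ?rpredV ?rpred_nat //.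
under eq_bigr do rewrite horner_coef; rewrite exchange_big; apply: rpred_sum => i _.
have [qi|qi] := boolP (q %| i)%N.
  have ui : u ^+ i = (u ^+ q) ^+ (i %/ q) by rewrite -exprM mulnC divnK.
  apply: rpred_sum => k _; rewrite exprMn ui; apply: rpredM => //.
  by apply: rpredM; apply: rpredX => //; apply: rpredX.
rewrite (_ : \sum_(k < q) _ = 0) ?rpred0 //.
rewrite (eq_bigr (fun k : 'I_q => (p`_i * u ^+ i) * (eta ^+ i) ^+ k)); last first.
  by move=> k _; rewrite exprMn -!exprM mulnC [RHS]mulrAC -mulrA.
rewrite -mulr_sumr; have : eta ^+ i != 1 by rewrite -(prim_order_dvd eta_prim).
rewrite -subr_eq0 => e1; apply/eqP; rewrite mulf_eq0; apply/orP; right.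
rewrite -(inj_eq (mulfI e1)) mulr0 -subrX1.
by rewrite -exprM mulnC exprM (prim_expr_order eta_prim) expr1n subrr.
Qed.

(** The denominator is replaced by its norm, the product of its conjugates [f k] for k < q;
    numerator and denominator are then polynomials in [u] with fixed values, to which [kummer_poly]
    applies. *)
Lemma kummer_fixed x : x \in adjoin M u -> s x = x -> x \in M.
Proof.
move=> /adjoinP[p [d [pM dM d0 xE]]] sx.
pose f k := d.[eta ^+ k * u].
have fS k : s (f k) = f k.+1.
  rewrite /f -horner_map rmorphM rmorphXn (sM etaM) su mulrA -exprSr.
  by congr horner; apply/polyP => i; rewrite coef_map /= sM // (polyOverP dM).
have f0 : f 0 = d.[u] by rewrite /f mul1r.
have f_neq0 k : f k != 0.
  by elim: k => [|k IH]; rewrite ?f0 // -fS fmorph_eq0.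
have fq : f q = d.[u] by rewrite /f (prim_expr_order eta_prim) mul1r.
have f_poly k : exists2 r, r \is a polyOver M & f k = r.[u].
  exists (d \Po (eta ^+ k *: 'X)); last by rewrite horner_comp !hornerE.
  by rewrite polyOver_comp // polyOverZ ?polyOverX // rpredX.
have prod_poly m (h : 'I_m -> nat) :
    exists2 r, r \is a polyOver M & \prod_k f (h k) = r.[u].
  elim/big_rec: _ => [|k _ _ [r rM ->]]; first by exists 1; rewrite ?rpred1 ?hornerC.
  by have [r' rM' ->] := f_poly (h k); exists (r' * r); rewrite ?rpredM ?hornerM.
move: fq (prim_order_gt0 eta_prim); case: q => // m fq _.
have [r rM rE] := prod_poly m (fun k => k.+1).
have N0 : f 0 * r.[u] != 0.
  by rewrite -rE mulf_neq0 //; apply/prodf_neq0.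
have sN : s (f 0 * r.[u]) = f 0 * r.[u].
  have NE : \prod_(k < m.+1) f k = f 0 * r.[u] by rewrite big_ord_recl -rE.
  rewrite -{1}NE rmorph_prod (eq_bigr (fun k : 'I_m.+1 => f k.+1)).
    by rewrite big_ord_recr /= fq rE f0 mulrC.
  by move=> k _; apply: fS.
have drE : (d * r).[u] = f 0 * r.[u] by rewrite hornerM f0.
have prE : (p * r).[u] = x * (d * r).[u].
  by rewrite xE !hornerM mulrA divfK.
rewrite -(mulfK N0 x) -drE -prE rpred_div // kummer_poly ?rpredM ?drE //.
by rewrite prE rmorphM sx drE sN.
Qed.

End Kummer.

Section Dedekind.

Variables (F : fieldType) (gT : finGroupType).
Variables (act : gT -> {rmorphism F -> F}) (L : divringClosed F).
Hypothesis actM : forall g h f, act (g * h)%g f = act g (act h f).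
Hypothesis faithful : forall g, (forall f, f \in L -> act g f = f) -> g = 1%g.

(** Artin's shortening of a relation: subtracting [act g0 f] times the relation at [h] from the
    relation at [f * h] cancels the term of [g0] and keeps that of [g1], once [f] in [L] separates
    the two. *)
Lemma dedekind (c : gT -> F) :
  (forall f, f \in L -> \sum_g c g * act g f = 0) -> forall g, c g = 0.
Proof.
have [m] := ubnP #|[set g | c g != 0]|; elim: m c => // m IH c cm sum0.
move=> g0; apply: contrapT => /eqP c0.
have [g1 g10 c1] : exists2 g1, g1 != g0 & c g1 != 0.
  apply: contrapT => no_g1; case/eqP: c0; rewrite -[RHS](sum0 1) ?rpred1 //.
  rewrite (bigD1 g0) //= rmorph1 mulr1 big1 ?addr0 // => g gg0.
  have [->|cg] := eqVneq (c g) 0; first by rewrite mul0r.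
  by case: no_g1; exists g.
have [f fL f01] : exists2 f, f \in L & act g1 f != act g0 f.
  apply: contrapT => no_f; case/eqP: g10; apply/eqP.
  rewrite eq_sym eq_mulVg1; apply/eqP.
  apply: faithful => f fL; apply: contrapT => nf; case: no_f; exists f => //.
  apply: contra_not_neq nf => e; rewrite actM e -actM mulVg.
  by apply: (fmorph_inj (act 1%g)); rewrite -actM mulg1.
pose c' g := c g * (act g f - act g0 f).
suff /(_ g1)/eqP : forall g, c' g = 0.
  by rewrite mulf_eq0 (negPf c1) subr_eq0 (negPf f01).
apply: IH => [|h hL].
  rewrite -ltnS; apply: leq_trans cm; rewrite ltnS; apply: proper_card.
  apply/properP; split; last by exists g0; rewrite !inE ?c0 // /c' subrr mulr0 eqxx.
  by apply/subsetP => g; rewrite !inE; apply: contraNneq => cg; rewrite /c' cg mul0r.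
transitivity (\sum_g c g * act g (f * h) - act g0 f * \sum_g c g * act g h).
  rewrite mulr_sumr -sumrB; apply: eq_bigr => g _.
  by rewrite rmorphM /c' mulrBr mulrBl !mulrA [act g0 f * _]mulrC.
by rewrite !sum0 ?rpredM // mulr0 subr0.
Qed.

End Dedekind.

(** * The group *)

(** A chained equality of the presentation becomes two equations with the last term in common. *)
Definition Gr_relations (gT : finGroupType) (q : nat) (a1 a2 b1 b2 c1 c2 : gT) :=
  ([&& [~ b1, a1] == b1 ^+ q, c1 == b1 ^+ q, [~ b2, a2] == b2 ^+ q,
      c2 == b2 ^+ q, [~ a1, a2] == c2, c1 ^+ q == 1, c2 ^+ q == 1,
      a1 ^+ q == 1, a2 ^+ q == 1, [~ a1, b2] == 1, [~ a1, c1] == 1,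
      [~ a1, c2] == 1, [~ a2, b1] == 1, [~ a2, c1] == 1, [~ a2, c2] == 1,
      [~ b1, b2] == 1, [~ b1, c1] == 1, [~ b1, c2] == 1, [~ b2, c1] == 1,
      [~ b2, c2] == 1 & [~ c1, c2] == 1])%g.

Definition Gr_generated (gT : finGroupType) (a1 a2 b1 b2 c1 c2 : gT) : {set gT} :=
  (<[a1]> <*> <[a2]> <*> <[b1]> <*> <[b2]> <*> <[c1]> <*> <[c2]>)%g.

Section PresentationFormulas.

Import Presentation.

(* [rel] packs all the relations into one equality of nested pairs. *)
Fixpoint holds (gT : finGroupType) (e : seq gT) (f : formula) : bool :=
  match f with
  | Eq2 s t => eval e s == eval e t
  | And f1 f2 => holds e f1 && holds e f2
  end.

Lemma and_relE (vT : finType) (v1 v2 : vT) r :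
  and_rel v1 v2 r = (v1 == v2) && r :> bool.
Proof. by case: r => //=; rewrite andbT. Qed.

Lemma rel_holds (gT : finGroupType) (e : seq gT) f r :
  rel e f r = holds e f && r :> bool.
Proof.
elim: f r => [s t|f1 IH1 f2 IH2] r /=; first exact: and_relE.
by rewrite IH1 IH2 andbA.
Qed.

(** Read from left to right on [gT], it supplies the generators; read from right to left on [pgrp],
    it makes the concrete group a quotient of the presented one. *)
Lemma homg_Gr (gT : finGroupType) (G : {set gT}) (q : nat) :
  (G \homg Grp
     (alpha1 : alpha2 : beta1 : beta2 : gamma1 : gamma2 :
       [~ beta1, alpha1] = gamma1 = beta1 ^+ q,
       [~ beta2, alpha2] = gamma2 = beta2 ^+ q,
       [~ alpha1, alpha2] = gamma2,
       gamma1 ^+ q = 1, gamma2 ^+ q = 1,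
       alpha1 ^+ q = 1, alpha2 ^+ q = 1,
       [~ alpha1, beta2] = 1, [~ alpha1, gamma1] = 1, [~ alpha1, gamma2] = 1,
       [~ alpha2, beta1] = 1, [~ alpha2, gamma1] = 1, [~ alpha2, gamma2] = 1,
       [~ beta1, beta2] = 1, [~ beta1, gamma1] = 1, [~ beta1, gamma2] = 1,
       [~ beta2, gamma1] = 1, [~ beta2, gamma2] = 1,
       [~ gamma1, gamma2] = 1))%g <->
  exists a1 a2 b1 b2 c1 c2, Gr_generated a1 a2 b1 b2 c1 c2 = G /\
    Gr_relations q a1 a2 b1 b2 c1 c2.
Proof.
split.
  move=> /existsP[[[[[[a1 a2] b1] b2] c1] c2]].
  rewrite [X in is_true X]and_relE rel_holds andbT => /andP[/eqP genG rels].
  exists a1, a2, b1, b2, c1, c2; split; first exact: genG.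
  by move: rels; rewrite /= -!andbA.
move=> [a1 [a2 [b1 [b2 [c1 [c2 [genG rels]]]]]]].
apply/existsP; exists (a1, a2, b1, b2, c1, c2).
rewrite [X in is_true X]and_relE rel_holds andbT -genG eqxx.
by rewrite /= -!andbA.
Qed.

End PresentationFormulas.

(** * A permutation group realising the two monomial representations *)

Section MonomialPermutations.

Variable q : nat.
Hypothesis q_gt1 : (1 < q)%N.
Local Notation Q := (q * q)%N.

(* The point [(s, t, e)] stands for [zeta ^+ e] times the basis vector [t] of
   the representation numbered [s]. *)
Definition point := (bool * 'Z_q * 'Z_Q)%type.

Implicit Types (k : bool -> 'Z_q) (c : bool -> 'Z_q -> 'Z_Q).

Definition mono_fun k c (w : point) : point :=
  let: (s, t, e) := w in (s, t + k s, e + c s t).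

Lemma mono_fun_inj k c : injective (mono_fun k c).
Proof.
move=> [[s t] e] [[s' t'] e'] /eqP; rewrite !xpair_eqE.
by move=> /andP[/andP[/eqP<- /eqP/addIr<-] /eqP/addIr<-].
Qed.

Definition mono k c : {perm point} := perm (@mono_fun_inj k c).

Lemma monoE k c s t e : mono k c (s, t, e) = (s, t + k s, e + c s t).
Proof. exact: permE. Qed.

Lemma monoM k c k' c' : (mono k c * mono k' c')%g =
  mono (fun s => k s + k' s) (fun s t => c s t + c' s (t + k s)).
Proof. by apply/permP => -[[s t] e]; rewrite permM !monoE !addrA. Qed.

Lemma eq_mono k c k' c' : k =1 k' -> c =2 c' -> mono k c = mono k' c'.
Proof. by move=> kk' cc'; apply/permP => -[[s t] e]; rewrite !monoE kk' cc'. Qed.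

Lemma mono1 : mono (fun=> 0) (fun _ _ => 0) = 1%g.
Proof. by apply/permP => -[[s t] e]; rewrite monoE perm1 !addr0. Qed.

Lemma monoX k c n : (forall s t, c s (t + k s) = c s t) ->
  (mono k c ^+ n)%g = mono (fun s => k s *+ n) (fun s t => c s t *+ n).
Proof.
move=> ck; elim: n => [|n IH]; first by rewrite expg0 -mono1; apply: eq_mono.
rewrite expgS IH monoM; apply: eq_mono => [s|s t]; first by rewrite mulrS.
by rewrite ck mulrS.
Qed.

Lemma commg_eq (gT : groupType) (x y z : gT) : (x * y = y * x * z)%g -> [~ x, y]%g = z.
Proof. by move=> xy; apply: (mulgI (y * x)%g); rewrite -xy -commgC. Qed.

(* The sign accounts for permutations acting on the right. *)
Definition slope (t : 'Z_q) : 'Z_Q := - (q * t)%:R.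

Lemma Q_gt1 : (1 < Q)%N.
Proof. by rewrite -[1%N]/(1 * 1)%N ltn_mul. Qed.

Lemma natr_Q_eq0 n : (Q %| n)%N -> n%:R = 0 :> 'Z_Q.
Proof.
by move=> /dvdnP[m ->]; rewrite natrM pchar_Zp ?Q_gt1 // mulr0.
Qed.

Lemma slope0 : slope 0 = 0.
Proof. by rewrite /slope muln0 oppr0. Qed.

(** The carry of the addition modulo [q] is a multiple of [q], and a further factor [q] kills it
    modulo [q * q]. *)
Lemma slopeD t t' : slope (t + t') = slope t + slope t'.
Proof.
rewrite /slope -opprD -natrD -mulnDr; congr (- _).
have -> : nat_of_ord (t + t') = ((t + t') %% q)%N.
  by rewrite -[X in (_ %% X)%N](Zp_cast q_gt1).
rewrite [in RHS](divn_eq (t + t') q) mulnDr natrD.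
by rewrite [X in _ = X + _]natr_Q_eq0 ?add0r // mulnCA dvdn_mull.
Qed.

Lemma slope1 : slope 1 = - q%:R.
Proof. by rewrite /slope muln1. Qed.

Lemma slope_mulrn t : slope t *+ q = 0.
Proof. by rewrite /slope mulNrn -mulrnA natr_Q_eq0 ?oppr0 // mulnAC dvdn_mulr. Qed.

Lemma qQ : q%:R *+ q = 0 :> 'Z_Q.
Proof. by rewrite -mulrnA natr_Q_eq0. Qed.

(** [false] and [true] stand for the indices 1 and 2. As [slope] drops by [q] when [t] advances by
    1, the exponent [1 + slope t] of beta_s makes its commutator with the shift the scalar zeta^q,
    and the twist of alpha_1 on the second representation yields [alpha_1, alpha_2] = gamma_2. *)
Definition palpha s := mono (fun s' => (s' == s)%:R)
  (fun s' t => if ~~ s && s' then slope t else 0).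
Definition pbeta s := mono (fun=> 0)
  (fun s' t => if s' == s then 1 + slope t else 0).
Definition pgamma s := mono (fun=> 0) (fun s' _ => if s' == s then q%:R else 0).

Lemma pgammaE s s' t e : pgamma s (s', t, e) =
  (s', t, e + (if s' == s then q%:R else 0)).
Proof. by rewrite monoE addr0. Qed.

Lemma pbetaE s s' t e : pbeta s (s', t, e) =
  (s', t, e + (if s' == s then 1 + slope t else 0)).
Proof. by rewrite monoE addr0. Qed.

Lemma pbetaX s n : (pbeta s ^+ n)%g =
  mono (fun=> 0) (fun s' t => (if s' == s then 1 + slope t else 0) *+ n).
Proof.
rewrite monoX => [|s' t]; last by rewrite addr0.
by apply: eq_mono => // s'; rewrite mul0rn.
Qed.

Lemma palphaX s n : (palpha s ^+ n)%g =
  mono (fun s' => (s' == s)%:R *+ n)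
    (fun s' t => (if ~~ s && s' then slope t else 0) *+ n).
Proof. by rewrite monoX // => -[] t; case: s => //=; rewrite addr0. Qed.

Lemma pgammaX s n : (pgamma s ^+ n)%g =
  mono (fun=> 0) (fun s' _ => (if s' == s then q%:R else 0) *+ n).
Proof.
by rewrite monoX //; apply: eq_mono => // s'; rewrite mul0rn.
Qed.

Lemma pbeta_expq s : (pbeta s ^+ q)%g = pgamma s.
Proof.
rewrite pbetaX; apply: eq_mono => // s' t; case: eqP => _; last exact: mul0rn.
by rewrite mulrnDl slope_mulrn addr0.
Qed.

Lemma palpha_expq s : (palpha s ^+ q)%g = 1%g.
Proof.
rewrite palphaX -mono1; apply: eq_mono => [s'|s' t].
  by case: (s' == s); rewrite ?mul0rn // -mulrnA mul1n pchar_Zp.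
by case: ifP => _; [apply: slope_mulrn | apply: mul0rn].
Qed.

Lemma pgamma_expq s : (pgamma s ^+ q)%g = 1%g.
Proof.
rewrite pgammaX -mono1; apply: eq_mono => // s' t.
by case: ifP; rewrite ?qQ ?mul0rn.
Qed.

Lemma pbeta_palpha s : [~ pbeta s, palpha s]%g = pgamma s.
Proof.
apply: commg_eq; rewrite !monoM; apply: eq_mono => [s'|s' t].
  by rewrite add0r !addr0.
rewrite addr0; case: s s' => -[] /=; rewrite ?(addr0, add0r) //.
  by rewrite slopeD slope1 addrA subrK.
by rewrite slopeD slope1 addrA subrK.
Qed.

Lemma palpha_palpha : [~ palpha false, palpha true]%g = pgamma true.
Proof.
apply: commg_eq; rewrite !monoM; apply: eq_mono => [s'|s' t].
  by rewrite addr0 addrC.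
by case: s'; rewrite /= ?(addr0, add0r) // slopeD slope1 subrK.
Qed.

Lemma pgrp_relations : Gr_relations q (palpha false) (palpha true)
  (pbeta false) (pbeta true) (pgamma false) (pgamma true).
Proof.
have comm1 (g h : {perm point}) : (g * h = h * g)%g -> ([~ g, h] == 1)%g.
  by move=> gh; apply/eqP/commg_eq; rewrite mulg1.
rewrite /Gr_relations !pbeta_expq !palpha_expq !pgamma_expq !pbeta_palpha.
rewrite palpha_palpha !eqxx /=.
by do ![apply/andP; split]; apply: comm1; rewrite !monoM; apply: eq_mono => -[] *;
  rewrite /= ?(addr0, add0r) // addrC.
Qed.

Definition pgrp : {set {perm point}} := Gr_generated (palpha false) (palpha true)
  (pbeta false) (pbeta true) (pgamma false) (pgamma true).

Canonical pgrp_group := [group of pgrp].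

Lemma pgrp_gens s : [/\ palpha s \in pgrp, pbeta s \in pgrp & pgamma s \in pgrp].
Proof.
have: pgrp \subset pgrp by [].
rewrite {1}/pgrp /Gr_generated !join_subG !cycle_subG -!andbA.
by case/and5P => ? ? ? ? /andP[? ?]; case: s.
Qed.

(** Exponents affine in [slope t] are stable under composition, as [slope] is additive. Those at [t]
    and [t + 1] differ by a constant, so ratios of consecutive basis vectors are permuted up to a
    scalar independent of [t]. *)
Definition is_mono (h : {perm point}) := exists (k : bool -> 'Z_q) (c m : bool -> 'Z_Q),
  forall s t e, h (s, t, e) = (s, t + k s, e + (c s + slope t * m s)).

Lemma is_mono_group : group_set [set h | `[< is_mono h >]].
Proof.
apply/group_setP; split=> [|g h].
  rewrite inE; apply/asboolP; exists (fun=> 0), (fun=> 0), (fun=> 0) => s t e.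
  by rewrite perm1 mulr0 !addr0.
rewrite !inE => /asboolP[k [c [m gE]]] /asboolP[k' [c' [m' hE]]]; apply/asboolP.
exists (fun s => k s + k' s), (fun s => c s + c' s + slope (k s) * m' s),
  (fun s => m s + m' s) => s t e.
rewrite permM gE hE slopeD; congr (_, _, _); first by rewrite addrA.
by ring.
Qed.

Lemma pgrp_mono h : h \in pgrp -> is_mono h.
Proof.
pose G := Group is_mono_group.
suff /subsetP sG : pgrp \subset G by move=> /sG; rewrite inE => /asboolP.
have G_alpha s : palpha s \in G.
  rewrite inE; apply/asboolP; exists (fun s' => (s' == s)%:R), (fun=> 0),
    (fun s' => (~~ s && s')%:R) => s' t e.
  by rewrite monoE add0r mulr_natr [slope t *+ _]mulrb.
have G_beta s : pbeta s \in G.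
  rewrite inE; apply/asboolP; exists (fun=> 0), (fun s' => (s' == s)%:R),
    (fun s' => (s' == s)%:R) => s' t e.
  by rewrite monoE; case: (s' == s) => /=; rewrite ?mulr1 ?mulr0 ?addr0.
have G_gamma s : pgamma s \in G.
  rewrite inE; apply/asboolP; exists (fun=> 0), (fun s' => if s' == s then q%:R else 0),
    (fun=> 0) => s' t e.
  by rewrite monoE mulr0 !addr0.
by rewrite /pgrp /Gr_generated !join_subG !cycle_subG !G_alpha !G_beta !G_gamma.
Qed.

(** The products beta_1^j beta_2^l alpha_1^i alpha_2^k are told apart by their values at the two
    points with [t = 0] and [e = 0]. In this order alpha_1 meets the second representation at
    [t = 0], where its twist vanishes. *)
Lemma card_pgrp : (Q * Q * q * q <= #|pgrp|)%N.
Proof.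
pose Phi (w : 'Z_Q * 'Z_Q * 'Z_q * 'Z_q) := (pbeta false ^+ w.1.1.1 *
  pbeta true ^+ w.1.1.2 * palpha false ^+ w.1.2 * palpha true ^+ w.2)%g.
have Phi0 w : Phi w (false, 0, 0) = (false, w.1.2, w.1.1.1).
  rewrite /Phi !permM !pbetaX !palphaX !monoE /=.
  by rewrite ?(mul0rn, addr0, add0r, slope0) !natr_Zp.
have Phi1 w : Phi w (true, 0, 0) = (true, w.2, w.1.1.2).
  rewrite /Phi !permM !pbetaX !palphaX !monoE /=.
  by rewrite ?(mul0rn, addr0, add0r, slope0) !natr_Zp.
have Phi_inj : injective Phi.
  move=> [[[j l] i] k] [[[j' l'] i'] k'] e.
  have := Phi0 (j, l, i, k); rewrite e Phi0 => -[-> ->].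
  by have := Phi1 (j, l, i, k); rewrite e Phi1 => -[-> ->].
have <- : #|{: 'Z_Q * 'Z_Q * 'Z_q * 'Z_q}| = (Q * Q * q * q)%N.
  by rewrite !card_prod !card_ord !Zp_cast ?Q_gt1.
rewrite -(card_codom Phi_inj); apply/subset_leq_card/subsetP => _ /codomP[w ->].
have [? ? _] := pgrp_gens false; have [? ? _] := pgrp_gens true.
by rewrite !groupM ?groupX.
Qed.

End MonomialPermutations.

(** * The order of the presented group *)

Lemma dvdn_card_join (gT : finGroupType) (A B : {group gT}) m n :
  (B \subset 'N(A))%g -> (#|A| %| m)%N -> (#|B| %| n)%N -> (#|(A <*> B)%g| %| m * n)%N.
Proof.
move=> nAB Am Bn; rewrite norm_joinEr //.
apply: dvdn_trans (dvdn_mul Am Bn); rewrite mul_cardG.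
exact: dvdn_mulr.
Qed.

(** [b1] and [b2] commute and have orders dividing q^2, [a1] normalises the group they generate, and
    [a2] the group generated by these three; [c1] and [c2] are powers of [b1] and [b2]. *)
Lemma card_Gr (gT : finGroupType) q (a1 a2 b1 b2 c1 c2 : gT) :
  Gr_relations q a1 a2 b1 b2 c1 c2 ->
  (#|Gr_generated a1 a2 b1 b2 c1 c2| %| (q * q) * (q * q) * q * q)%N.
Proof.
move=> /and5P[/eqP b1a1 /eqP c1E /eqP b2a2 /eqP c2E].
move=> /and5P[/eqP a1a2 /eqP c1q /eqP c2q /eqP a1q].
move=> /and5P[/eqP a2q a1b2 _ _ /and5P[a2b1 _ _ b1b2 _]].
have comm_norm (g h : gT) : ([~ g, h] == 1)%g -> (<[g]> \subset 'N(<[h]>))%g.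
  rewrite commg1_sym => /conjg_fixP gh.
  by rewrite norms_cycle gh cycle_id.
have order_q (g : gT) : (g ^+ q = 1)%g -> (#|<[g]>%g| %| q)%N.
  by move=> gq; rewrite -orderE order_dvdn gq.
have order_qq (g c : gT) : (c = g ^+ q)%g -> (c ^+ q = 1)%g -> (#|<[g]>%g| %| q * q)%N.
  by move=> -> cq; rewrite -orderE order_dvdn expgM cq.
have nb2 : (<[b2]> \subset 'N(<[b1]>))%g by apply: comm_norm; rewrite commg1_sym.
pose A := (<[b1]> <*> <[b2]>)%G.
have na1 : (<[a1]> \subset 'N(A))%g.
  apply: normsY; last exact: comm_norm.
  by rewrite norms_cycle conjg_mulR b1a1 -expgS mem_cycle.
have na2A : (<[a2]> \subset 'N(A))%g.
  apply: normsY; first exact: comm_norm.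
  by rewrite norms_cycle conjg_mulR b2a2 -expgS mem_cycle.
pose B := (A <*> <[a1]>)%G.
have AB : A \subset B by apply: joing_subl.
have [b1A b2A] : b1 \in A /\ b2 \in A.
  by rewrite -!cycle_subG joing_subl joing_subr.
have a1B : a1 \in B by rewrite -cycle_subG joing_subr.
have na2 : (<[a2]> \subset 'N(B))%g.
  have /normP Aa2 : a2 \in 'N(A)%g by rewrite -cycle_subG.
  rewrite cycle_subG inE conjYg Aa2 -cycleJ join_subG AB cycle_subG.
  by rewrite conjg_mulR a1a2 c2E groupM ?groupX // (subsetP AB).
pose C := (B <*> <[a2]>)%G.
have BC : B \subset C by apply: joing_subl.
have sC : Gr_generated a1 a2 b1 b2 c1 c2 \subset C.
  have a2C : a2 \in C by rewrite -cycle_subG joing_subr.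
  have AC x : x \in A -> x \in C by move=> /(subsetP AB)/(subsetP BC).
  rewrite /Gr_generated !join_subG !cycle_subG c1E c2E.
  by rewrite (subsetP BC _ a1B) a2C !groupX ?AC.
apply: dvdn_trans (cardSg sC) _.
apply: dvdn_card_join na2 _ (order_q _ a2q).
apply: dvdn_card_join na1 _ (order_q _ a1q).
exact: dvdn_card_join nb2 (order_qq _ _ c1E c1q) (order_qq _ _ c2E c2q).
Qed.

Lemma Gr_pgroup (gT : finGroupType) (p r : nat) : prime p ->
  (exists a1 a2 b1 b2 c1 c2, Gr_generated a1 a2 b1 b2 c1 c2 = [set: gT] /\
    Gr_relations (p ^ r) a1 a2 b1 b2 c1 c2) -> (p.-group [set: gT])%g.
Proof.
move=> p_pr [a1 [a2 [b1 [b2 [c1 [c2 [genG /card_Gr]]]]]]]; rewrite genG => dG.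
by apply: pnat_dvd dG _; rewrite !pnatM !pnatX pnat_id.
Qed.

(** The upper bound from the relations and the lower bound from the permutations coincide, so an
    epimorphism onto [pgrp] is injective. *)
Lemma Gr_copy (gT : finGroupType) q (q_gt1 : (1 < q)%N) :
  (exists a1 a2 b1 b2 c1 c2, Gr_generated a1 a2 b1 b2 c1 c2 = [set: gT] /\
    Gr_relations q a1 a2 b1 b2 c1 c2) ->
  (pgrp q \homg [set: gT])%g ->
  exists f : gT -> {perm point q}, [/\ {morph f : g h / (g * h)%g},
    injective f, forall g, is_mono (f g)
    & forall h, h \in pgrp q -> exists g, f g = h].
Proof.
move=> [a1 [a2 [b1 [b2 [c1 [c2 [genG /card_Gr]]]]]]]; rewrite genG => dG.
move=> /homgP[f fG]; have q_gt0 := ltnW q_gt1.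
have fM : {morph f : g h / (g * h)%g} by move=> g h; rewrite morphM ?inE.
exists f; split=> // [|g|h].
- have inj : ('injm f)%g.
    rewrite -card_im_injm fG eqn_leq -{1}fG leq_morphim /=.
    apply: leq_trans (card_pgrp q_gt1); apply: dvdn_leq dG.
    by rewrite !muln_gt0 q_gt0.
  by move=> g h; apply: (injmP inj); rewrite inE.
- by apply: (pgrp_mono q_gt1); rewrite -fG mem_morphim ?inE.
- by rewrite -fG => /morphimP[g _ _ ->]; exists g.
Qed.

(** * The regular representation *)

Section RegularAction.

Variables (K F : fieldType) (iota : {rmorphism K -> F}) (gT : finGroupType).
Variables (act : gT -> {rmorphism F -> F}) (x : gT -> F).
Hypothesis actM : forall g h f, act (g * h)%g f = act g (act h f).
Hypothesis act_iota : forall g c, act g (iota c) = iota c.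
Hypothesis act_x : forall g h, act g (x h) = x (g * h)%g.
Local Notation K0 := (base iota).
Local Notation xs := [seq x g | g <- enum gT].
Hypothesis x_chain : chain K0 xs.
Hypothesis x_gens : forall f, f \in gens K0 xs.

Definition rational_invariants :=
  exists2 fs, chain K0 fs & forall f, act_invariant act f = (f \in gens K0 fs).

Lemma fixed_base : fixed act K0 =i K0.
Proof. by apply: fixed_id => g f /baseP[c ->]. Qed.

Lemma base_stable : act_stable act K0.
Proof. by move=> g f /baseP[c ->]; rewrite act_iota mem_base. Qed.

Lemma all_in (T : divringClosed F) : {subset K0 <= T} ->
  (forall g, x g \in T) -> forall f, f \in T.
Proof.
move=> KT xT f; move: (x_gens f); apply: gens_min => // _ /mapP[g _ ->].
exact: xT.
Qed.

Lemma x_generators_chain ys : (size ys <= #|gT|)%N ->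
  (forall g, x g \in algcl (gens K0 ys)) -> chain K0 ys.
Proof.
move=> sz ysP; apply: (generators_chain x_chain) => [|_ /mapP[g _ ->]] //.
by rewrite size_map -cardE.
Qed.

(** At most |G| generators are independent by [x_generators_chain], so for Miyata's theorem only the
    affine shape of the action is left to check. *)
Lemma rational_of_affine_chain ys : (size ys <= #|gT|)%N ->
  affine_chain act K0 ys -> (forall g, x g \in gens K0 ys) ->
  rational_invariants.
Proof.
move=> sz aff gen_x; have gen_all := all_in (@gens_base _ K0 ys) gen_x.
have [|fs chf fsE] := miyata_chain actM base_stable _ aff.
  by apply: x_generators_chain => // g; apply: algcl_base.
exists fs => [|f].
  by apply: chainW chf => z; rewrite -fixed_base; apply: algcl_base.
have -> : act_invariant act f = (f \in fixed act (gens K0 ys)).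
  by rewrite [RHS]inE /= gen_all.
rewrite fsE; apply/idP/idP; apply: gensS => z; by rewrite fixed_base.
Qed.

Lemma affine_chain_rcons S ys y : affine_chain act S ys ->
  affine_over act (gens S ys) y -> affine_chain act S (rcons ys y).
Proof.
elim: ys S => [|z ys IH] S /=; first by [].
by move=> [? ?] ?; split=> //; apply: IH.
Qed.

(** * Characteristic p: an invariant flag of the regular representation *)

Section CharP.

Variable p : nat.
Hypotheses (pK : p \in [pchar K]) (pG : (p.-group [set: gT])%g).
Local Notation n := #|gT|.

Definition lin (v : 'rV[K]_n) : F := \sum_i iota (v 0 i) * x (enum_val i).

Lemma linD v w : lin (v + w) = lin v + lin w.
Proof.
rewrite /lin -big_split; apply: eq_bigr => i _.
by rewrite mxE rmorphD mulrDl.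
Qed.

Lemma linZ c v : lin (c *: v) = iota c * lin v.
Proof.
rewrite /lin mulr_sumr; apply: eq_bigr => i _.
by rewrite mxE rmorphM mulrA.
Qed.

Lemma lin_delta g : lin (delta_mx 0 (enum_rank g)) = x g.
Proof.
rewrite /lin (bigD1 (enum_rank g)) //= mxE !eqxx rmorph1 mul1r enum_rankK.
by rewrite big1 ?addr0 // => i /negPf ig; rewrite mxE ig rmorph0 mul0r.
Qed.

(* Row vectors are acted upon on the right, hence the inverse. *)
Definition reg_mx (g : gT) : 'M[K]_n :=
  \matrix_i delta_mx 0 (enum_rank (g^-1 * enum_val i)%g).

Lemma reg_mx_repr : mx_repr [set: gT] reg_mx.
Proof.
split=> [|g h _ _]; apply/row_matrixP => i; rewrite rowK.
  by rewrite row1 invg1 mul1g enum_valK.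
by rewrite row_mul rowK -rowE rowK enum_rankK invMg mulgA.
Qed.

Canonical reg_repr := MxRepresentation reg_mx_repr.

Lemma lin_reg g v : lin (v *m reg_mx g) = act g^-1%g (lin v).
Proof.
rewrite mulmx_sum_row [in RHS]/lin rmorph_sum.
rewrite (big_morph lin linD (id1 := 0)); last first.
  by rewrite -[0 in LHS](scale0r 0) linZ rmorph0 mul0r.
apply: eq_bigr => i _.
by rewrite rowK linZ lin_delta rmorphM act_iota act_x.
Qed.

(** In characteristic p a p-group fixes a non-zero vector of every non-zero module, here the
    quotient by [M]. Each [g] moves a lift [v] of it by an element of [M], hence translates [lin v]
    by an element of the field already built. *)
Lemma unipotent_flag k : (k <= n)%N -> exists ys (M : 'M[K]_n),
  [/\ size ys = k, \rank M = k, mxmodule reg_repr M, affine_chain act K0 ys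
    & forall v, (v <= M)%MS -> lin v \in gens K0 ys].
Proof.
elim: k => [_|k IH kn].
  exists [::], 0; split=> //; rewrite ?mxrank0 ?mxmodule0 // => v.
  rewrite submx0 => /eqP->; rewrite -(scale0r 0) linZ rmorph0 mul0r.
  exact: rpred0.
have [ys [M [sys rM modM aff linM]]] := IH (ltnW kn).
pose rQ := factmod_repr modM.
have dQ : (0 < \rank (cokermx M))%N by rewrite mxrank_coker rM subn_gt0.
have := rfix_pgroup_pchar pK rQ dQ pG (subxx _).
move=> /rowV0Pn[w /rfix_mxP wfix w0].
pose v := val_factmod w.
have vM : ~~ (v <= M)%MS by rewrite -in_factmod_eq0 val_factmodK.
have vfix g : (v *m reg_mx g - v <= M)%MS.
  rewrite -in_factmod_eq0 linearB /= (in_factmodJ modM) ?inE //.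
  by rewrite val_factmodK wfix ?inE // subrr.
have vE g : act g (lin v) = lin v + lin (v *m reg_mx g^-1%g - v).
  by rewrite -linD addrC subrK lin_reg invgK.
exists (rcons ys (lin v)), (M + v)%MS; split.
- by rewrite size_rcons sys.
- apply/eqP; rewrite eqn_leq; apply/andP; split.
    have [le_rank _] := mxrank_adds_leqif M v.
    by rewrite (leq_trans le_rank) // rM -(addn1 k) leq_add2l rank_leq_row.
  have: (M < M + v)%MS by rewrite ltmxE addsmxSl addsmx_sub submx_refl.
  by rewrite ltmxErank rM => /andP[].
- apply/mxmoduleP => g Gg; rewrite addsmxMr addsmx_sub.
  rewrite (submx_trans (mxmoduleP modM g Gg)) ?addsmxSl //=.
  rewrite -[v *m _](subrK v) addmx_sub ?addsmxSr //.
  exact: submx_trans (vfix g) (addsmxSl _ _).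
- apply: affine_chain_rcons => // g.
  exists 1, (lin (v *m reg_mx g^-1%g - v)).
  by rewrite rpred1 oner_neq0 mul1r linM.
- move=> u /sub_addsmxP[[a b] ->]; rewrite -cats1 gens_cat /= linD.
  apply: rpredD; first by apply: adjoin_base; rewrite linM ?submxMl.
  rewrite [b]mx11_scalar mul_scalar_mx linZ rpredM ?adjoin_gen //.
  by apply: adjoin_base; apply: gens_base; apply: mem_base.
Qed.

Theorem rational_char_p : rational_invariants.
Proof.
have [ys [M [sys rM _ aff linM]]] := unipotent_flag (leqnn n).
apply: (rational_of_affine_chain _ aff) => [|g]; first by rewrite sys.
by rewrite -lin_delta linM // submx_full // /row_full rM.
Qed.

End CharP.

(** * Invariant linear forms and linear independence of the variables *)

Lemma sum_enum_val (R : nmodType) (f : gT -> R) :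
  \sum_(i < #|gT|) f (enum_val i) = \sum_g f g.
Proof.
rewrite [RHS](reindex (@enum_val gT gT)) //.
by exists enum_rank => i _; rewrite ?enum_valK ?enum_rankK.
Qed.

Lemma spanmx_min (m : nat) (s : seq 'rV[F]_#|gT|) (D : 'M[F]_(m, #|gT|)) :
  (forall v, v \in s -> (v <= D)%MS) -> (spanmx s <= D)%MS.
Proof.
rewrite /spanmx; elim: s => [|v s IH] sD; first by rewrite big_nil sub0mx.
rewrite big_cons addsmx_sub genmxE sD ?mem_head // IH // => w ws.
by apply: sD; rewrite inE ws orbT.
Qed.

Definition form (v : 'rV[F]_#|gT|) : F := \sum_i v 0 i * x (enum_val i).

Lemma orbit_form_invariant f :
  act_invariant act (form (\row_i act (enum_val i) f)).
Proof.
apply/act_invariantP => h; rewrite /form.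
under eq_bigr do rewrite mxE; rewrite (sum_enum_val (fun g => act g f * x g)).
rewrite rmorph_sum [RHS](reindex_inj (mulgI h)) /=; apply: eq_bigr => g _.
by rewrite rmorphM actM act_x.
Qed.

(* Speiser's lemma ("no-name lemma"): by Dedekind's independence of characters
   the invariant forms [\sum_g (act g f) * x g], with [f] in [L], complete any
   free family of forms with coefficients in [L] to a basis. *)
Lemma no_name (L : divringClosed F) (bs : seq 'rV[F]_#|gT|) :
  act_stable act L -> (forall g, (forall f, f \in L -> act g f = f) -> g = 1%g) ->
  (forall b i, b \in bs -> b 0 i \in L) -> (forall b, b \in bs -> form b \in L) ->
  \rank (spanmx bs) = size bs ->
  exists fs, [/\ (size bs + size fs)%N = #|gT|,
    forall f, f \in fs -> act_invariant act f & forall g, x g \in gens L fs].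
Proof.
move=> Lst faithL bsL fbsL rbs.
pose P (v : 'rV[F]_#|gT|) := exists2 f, f \in L & v = \row_i act (enum_val i) f.
have Pspan (c : 'cV[F]_#|gT|) : (forall v, P v -> v *m c = 0) -> c = 0.
  move=> c0; pose c' g := c (enum_rank g) 0.
  suff c'0 g : c' g = 0.
    by apply/colP => i; rewrite mxE -[i]enum_valK -/(c' _) c'0.
  apply: (dedekind actM faithL) => f fL.
  have /matrixP/(_ 0 0) : (\row_i act (enum_val i) f) *m c = 0 by apply: c0; exists f.
  rewrite !mxE -(sum_enum_val (fun g => c' g * act g f)) => e; rewrite -[RHS]e.
  by apply: eq_bigr => i _; rewrite mxE /c' enum_valK mulrC.
have [rs rsP [ss rr]] := complete_basis Pspan rbs.
set s := bs ++ rs in ss rr.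
pose D := \matrix_(i < #|gT|) nth 0 s i.
have sD v : v \in s -> (v <= D)%MS.
  move=> /(nthP 0)[i ilt <-]; rewrite ss in ilt.
  have -> : nth 0 s i = row (Ordinal ilt) D by rewrite rowK.
  exact: row_sub.
have Dunit : D \in unitmx.
  rewrite -row_full_unit -col_leq_rank; apply: leq_trans (mxrankS (spanmx_min sD)).
  by rewrite rr.
exists (map form rs); split=> [|_ /mapP[v /rsP[f _ ->] ->]|g].
- by rewrite size_map -size_cat.
- exact: orbit_form_invariant.
have DL i j : D i j \in gens L (map form rs).
  apply: gens_base; rewrite mxE; have : nth 0 s i \in s by rewrite mem_nth ?ss.
  rewrite mem_cat => /orP[/bsL//|/rsP[f fL ->]].
  by rewrite mxE; apply: Lst.
have fsL v : v \in s -> form v \in gens L (map form rs).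
  rewrite mem_cat => /orP[/fbsL/gens_base->//|vrs].
  by apply: gens_gen; apply: map_f.
pose X : 'cV[F]_#|gT| := \col_i x (enum_val i).
have <- : X (enum_rank g) 0 = x g by rewrite mxE enum_rankK.
(* The matrix [D] of the forms has entries in the subfield, so its inverse has too, and the
   variables are recovered from the forms. *)
rewrite -(mulKmx Dunit X) mxE; apply: rpred_sum => i _; apply: rpredM.
  exact: rpred_invmx.
suff -> : (D *m X) i 0 = form (nth 0 s i) by rewrite fsL // mem_nth ?ss.
by rewrite mxE; apply: eq_bigr => j _; rewrite !mxE.
Qed.

Lemma invariant_affine_chain S fs :
  (forall f, f \in fs -> act_invariant act f) -> affine_chain act S fs.
Proof.
elim: fs S => [//|f fs IH] S inv /=; split=> [g|]; last first.
  by apply: IH => h hfs; apply: inv; rewrite inE hfs orbT.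
exists 1, 0; rewrite rpred1 rpred0 oner_neq0 mul1r addr0; split=> //.
exact: (act_invariantP _ _ (inv f (mem_head _ _))).
Qed.

Lemma scaled_affine_chain (S : divringClosed F) ys : {subset K0 <= S} ->
  (forall y g, y \in ys -> exists2 c, c != 0 & act g y = iota c * y) ->
  affine_chain act S ys.
Proof.
elim: ys S => [//|y ys IH] S KS yE /=; split=> [g|]; last first.
  apply: IH => [z /KS|z g zys]; first exact: adjoin_base.
  by apply: yE; rewrite inE zys orbT.
have [c c0 ->] := yE y g (mem_head _ _); exists (iota c), 0.
by rewrite KS ?mem_base // rpred0 fmorph_eq0 addr0.
Qed.

(** A relation with [c g] non-zero would put [x g] in the field of the other |G| - 1 variables,
    against [chain_size]. *)
Lemma x_independent (c : gT -> K) : \sum_g iota (c g) * x g = 0 ->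
  forall g, c g = 0.
Proof.
move=> sum0 g; apply: contrapT => /eqP cg.
pose ys := [seq x h | h <- rem g (enum gT)].
have gE : g \in enum gT by rewrite mem_enum.
have xg : x g \in gens K0 ys.
  have -> : x g = - (iota (c g))^-1 * \sum_(h | h != g) iota (c h) * x h.
    move: sum0; rewrite (bigD1 g) //= => /eqP; rewrite addrC addr_eq0 => /eqP ->.
    by rewrite mulrNN mulKf // fmorph_eq0.
  rewrite rpredM //.
    by rewrite rpredN rpredV gens_base ?mem_base.
  apply: rpred_sum => h hg; rewrite rpredM //.
    by rewrite gens_base ?mem_base.
  by apply: gens_gen; apply: map_f; rewrite mem_rem_uniq ?enum_uniq // !inE hg mem_enum.
have: (size xs <= size ys)%N.
  apply: chain_size x_chain _ => _ /mapP[h _ ->]; apply: algcl_base.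
  have [->//|hg] := eqVneq h g; apply: gens_gen; apply: map_f.
  by rewrite mem_rem_uniq ?enum_uniq // !inE hg mem_enum.
have n0 : (0 < #|gT|)%N by apply/card_gt0P; exists g.
by rewrite !size_map size_rem // -enumT -!cardE leqNgt ltn_predL n0.
Qed.

Lemma free_family_rank (I : finType) (b : I -> 'rV[K]_#|gT|) :
  (forall c : I -> K, \sum_i c i *: b i = 0 -> forall i, c i = 0) ->
  \rank (spanmx [seq map_mx iota (b i) | i <- enum I]) = #|I|.
Proof.
move=> free_b; pose B := \matrix_(i < #|I|) b (enum_val i).
have Bfree : row_free B.
  apply: inj_row_free => v vB; apply/rowP => i; rewrite mxE -[i]enum_valK.
  apply: (free_b (fun i => v 0 (enum_rank i))); rewrite -[RHS]vB mulmx_sum_row.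
  rewrite [LHS](reindex (@enum_val I I)) /=; last first.
    by exists enum_rank => j _; rewrite ?enum_valK ?enum_rankK.
  by apply: eq_bigr => j _; rewrite rowK enum_valK.
have rB : \rank (map_mx iota B) = #|I| by rewrite mxrank_map; apply/eqP.
rewrite -rB; apply: eqmx_rank; apply/andP; split.
  apply: spanmx_min => _ /mapP[i _ ->].
  have -> : map_mx iota (b i) = row (enum_rank i) (map_mx iota B).
    by apply/rowP => j; rewrite !mxE enum_rankK.
  exact: row_sub.
apply/row_subP => i; rewrite -map_row rowK.
by apply: spanmx_sub; apply/mapP; exists (enum_val i); rewrite ?mem_enum.
Qed.

(** * The tower over K in the monomial case *)

Section Monomial.

Variables (q : nat) (zeta : K).
Hypotheses (q_gt1 : (1 < q)%N) (zeta_prim : (q * q).-primitive_root zeta).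
Hypothesis qK : q%:R != 0 :> K.
Variable b : bool * 'Z_q -> 'rV[K]_#|gT|.
Hypothesis b_free : forall c : bool * 'Z_q -> K,
  \sum_i c i *: b i = 0 -> forall i, c i = 0.
Definition mvar s t : F := form (map_mx iota (b (s, t))).
Hypothesis act_mvar : forall g s, exists (k : 'Z_q) (c m : nat), forall t : 'Z_q,
  act g (mvar s t) = iota (zeta ^+ (c + q * m * t)) * mvar s (t + k).
Hypothesis act_scale : forall s, exists g (c : nat), forall s' (t : 'Z_q),
  act g (mvar s' t) = (if s == s' then iota (zeta ^+ (c + q * t)) else 1) * mvar s' t.
Hypothesis act_faithful : forall g,
  (forall s t, act g (mvar s t) = mvar s t) -> g = 1%g.

Let eta := zeta ^+ q.

Lemma q_gt0 : (0 < q)%N. Proof. exact: ltnW. Qed.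

Lemma eta_prim : q.-primitive_root eta.
Proof.
rewrite /eta; have := exp_prim_root zeta_prim q.
by rewrite (gcdn_idPl (dvdn_mulr _ (dvdnn q))) mulnK // q_gt0.
Qed.

Lemma eta_addZ (t k : 'Z_q) : eta ^+ (t + k)%R = eta ^+ t * eta ^+ k.
Proof.
rewrite -exprD -(prim_expr_mod eta_prim (t + k)%N).
by rewrite -[X in (_ %% X)%N](Zp_cast q_gt1).
Qed.

Definition chi (j t : 'Z_q) := eta ^+ (t * j).

Lemma chiD j t k : chi j (t + k) = chi j t * chi j k.
Proof. by rewrite /chi !exprM eta_addZ exprMn. Qed.

Lemma zeta_neq0 : zeta != 0.
Proof.
apply/negP => /eqP z0; have /eqP := prim_expr_order zeta_prim.
by rewrite z0 expr0n gtn_eqF ?(prim_order_gt0 zeta_prim) // eq_sym oner_eq0.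
Qed.

Lemma chi_neq0 j t : chi j t != 0.
Proof. by rewrite !expf_neq0 ?zeta_neq0. Qed.

Lemma chi_sum (t : 'Z_q) : t != 0 -> \sum_j chi j t = 0.
Proof.
move=> t0; have et : eta ^+ t - 1 != 0.
  rewrite subr_eq0 -(prim_order_dvd eta_prim); apply: contraNN t0 => /dvdnP[[|m] tE].
    by apply/eqP/val_inj.
  have := ltn_ord t; rewrite [X in (_ < X)%N]Zp_cast // tE ltnNge mulSn leq_addr //.
apply: (mulfI et); rewrite mulr0 (eq_bigr (fun j : 'Z_q => (eta ^+ t) ^+ j)).
  rewrite -subrX1 -exprM mulnC exprM [X in eta ^+ X]Zp_cast //.
  by rewrite (prim_expr_order eta_prim) expr1n subrr.
by move=> j _; rewrite /chi exprM.
Qed.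

Lemma mvar_neq0 s t : mvar s t != 0.
Proof.
apply/negP => /eqP X0; pose c (i : bool * 'Z_q) : K := (i == (s, t))%:R.
suff b0 : b (s, t) = 0.
  suff /eqP : c (s, t) = 0 by rewrite /c eqxx oner_eq0.
  apply: b_free; rewrite (bigD1 (s, t)) //= b0 scaler0 add0r big1 // => i ist.
  by rewrite /c (negPf ist) scale0r.
apply/rowP => i; rewrite [RHS]mxE -[i]enum_valK.
apply: (x_independent (c := fun g => b (s, t) 0 (enum_rank g))).
rewrite -[RHS]X0 -sum_enum_val; apply: eq_bigr => j _.
by rewrite mxE enum_valK.
Qed.

Let u s t := mvar s (t + 1) / mvar s t.
Let z s j := \sum_t iota (chi j t) * u s t.

Lemma u_neq0 s t : u s t != 0.
Proof. by rewrite mulf_neq0 ?invr_eq0 ?mvar_neq0. Qed.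

Lemma act_u g s : exists (k : 'Z_q) (c : K),
  c != 0 /\ forall t, act g (u s t) = iota c * u s (t + k).
Proof.
have [k [c [m gE]]] := act_mvar g s.
have zE (t : 'Z_q) : zeta ^+ (c + q * m * t) = zeta ^+ c * (eta ^+ t) ^+ m.
  by rewrite exprD /eta -!exprM -mulnA [(m * t)%N]mulnC mulnA.
exists k, (eta ^+ m); split=> [|t]; first by rewrite !expf_neq0 ?zeta_neq0.
rewrite /u fmorph_div !gE addrAC -mulf_div -fmorph_div; congr (iota _ * _).
rewrite !zE eta_addZ expr1 exprMn -mulf_div divff ?mul1r.
  by rewrite mulrAC divff ?mul1r // !expf_neq0 ?zeta_neq0.
by rewrite expf_neq0 ?zeta_neq0.
Qed.

Lemma u_inversion s t : iota q%:R * u s t = \sum_j iota (chi j t)^-1 * z s j.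
Proof.
under eq_bigr do rewrite mulr_sumr.
rewrite exchange_big (bigD1 t) //= [X in _ + X]big1 ?addr0 => [|k kt].
  under eq_bigr do rewrite mulrA -rmorphM mulVf ?chi_neq0 // rmorph1 mul1r.
  by rewrite sumr_const card_ord Zp_cast // rmorph_nat mulr_natl.
rewrite (eq_bigr (fun j => iota (chi j (k - t)) * u s k)) => [|j _].
  by rewrite -mulr_suml -rmorph_sum chi_sum ?subr_eq0 // rmorph0 mul0r.
rewrite mulrA -rmorphM; congr (iota _ * _); apply: (mulfI (chi_neq0 j t)).
by rewrite mulrA mulfV ?chi_neq0 // mul1r -chiD addrC subrK.
Qed.

Lemma act_z g s : exists c : 'Z_q -> K, forall j,
  c j != 0 /\ act g (z s j) = iota (c j) * z s j.
Proof.
have [k [c [c0 gE]]] := act_u g s; exists (fun j => c / chi j k) => j.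
split; first by rewrite mulf_neq0 ?invr_eq0 ?chi_neq0.
rewrite /z rmorph_sum [in RHS](reindex_inj (addIr k)) mulr_sumr.
apply: eq_bigr => t _; rewrite rmorphM act_iota gE.
have e : c / chi j k * chi j (t + k) = chi j t * c.
  by rewrite chiD [chi j t * _]mulrC mulrA divfK ?chi_neq0 // mulrC.
by rewrite !mulrA -[in LHS]rmorphM -[in RHS]rmorphM e.
Qed.

(** By Fourier inversion the transforms cannot all vanish; one that does not serves as the common
    denominator of the [w]. *)
Lemma z_neq0_exists s : exists j, z s j != 0.
Proof.
apply: contrapT => no_j; have /eqP[] := u_neq0 s 0.
have q0 : iota q%:R != 0 by rewrite fmorph_eq0.
apply: (mulfI q0); rewrite u_inversion mulr0 big1 // => j _.
by have [->|zj] := eqVneq (z s j) 0; [rewrite mulr0 | case: no_j; exists j].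
Qed.

Let j0 s := xchoose (z_neq0_exists s).
Let w s j := z s j / z s (j0 s).
Let zs := [seq w s j | s <- [:: false; true], j <- rem (j0 s) (enum 'Z_q)].
Let M := gens K0 zs.

Lemma z_j0_neq0 s : z s (j0 s) != 0.
Proof. exact: xchooseP (z_neq0_exists s). Qed.

Lemma size_zs : size zs = (q.-1 + q.-1)%N.
Proof.
have sq (j : 'Z_q) : size (rem j (enum 'Z_q)) = q.-1.
  by rewrite size_rem ?mem_enum // -cardE card_ord Zp_cast.
by rewrite size_allpairs_dep /= !sq addn0.
Qed.

Lemma w_in s j : w s j \in M.
Proof.
have [->|jj0] := eqVneq j (j0 s); first by rewrite /w divff ?z_j0_neq0 ?rpred1.
apply: gens_gen; apply/allpairsPdep; exists s, j; split=> //.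
  by case: (s); rewrite !inE.
by rewrite mem_rem_uniq ?enum_uniq // !inE jj0 mem_enum.
Qed.

Lemma zs_scaled y g : y \in zs -> exists2 c, c != 0 & act g y = iota c * y.
Proof.
move=> /allpairsPdep[s [j [_ _ ->]]]; have [c cE] := act_z g s.
have [c0 cj] := cE j; have [c0' cj0] := cE (j0 s).
exists (c j / c (j0 s)); first by rewrite mulf_neq0 ?invr_eq0.
by rewrite /w fmorph_div cj cj0 -mulf_div fmorph_div.
Qed.

Lemma iota_M c : iota c \in M.
Proof. by apply: gens_base; apply: mem_base. Qed.

Lemma zs_affine : affine_chain act K0 zs.
Proof. by apply: scaled_affine_chain => // y g; apply: zs_scaled. Qed.

Lemma M_stable : act_stable act M.
Proof. exact: gens_stable base_stable zs_affine. Qed.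

(** Fourier inversion, divided by [z s (j0 s)], writes each [u s t / z s (j0 s)] as a combination of
    the [w]. *)
Lemma u_ratio s t t' : u s t / u s t' \in M.
Proof.
have uz r : u s r / z s (j0 s) \in M.
  have q0 : iota q%:R != 0 by rewrite fmorph_eq0.
  have -> : u s r / z s (j0 s) = (iota q%:R)^-1 * \sum_j iota (chi j r)^-1 * w s j.
    rewrite -[u s r](mulKf q0) u_inversion -mulrA; congr (_ * _).
    by rewrite mulr_suml; apply: eq_bigr => j _; rewrite mulrA.
  rewrite rpredM ?rpredV ?iota_M //; apply: rpred_sum => j _.
  by rewrite rpredM ?rpredV ?iota_M ?w_in.
have -> : u s t / u s t' = (u s t / z s (j0 s)) / (u s t' / z s (j0 s)).
  by rewrite invf_div mulrA divfK ?z_j0_neq0.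
by rewrite rpred_div.
Qed.

Lemma u0_power s : u s 0 ^+ q \in M.
Proof.
have prod_u : \prod_t u s t = 1.
  rewrite prodf_div [X in _ / X](reindex_inj (addIr 1)) /= divff //.
  by apply/prodf_neq0 => t _; apply: mvar_neq0.
have -> : u s 0 ^+ q = \prod_t (u s 0 / u s t).
  by rewrite prodf_div prod_u divr1 prodr_const card_ord Zp_cast.
by apply: rpred_prod => t _; apply: u_ratio.
Qed.

(** This is K(u): by [u_ratio], a single [u s 0] for each [s] yields the other [u s t] over [M]. *)
Let L1 := adjoin (adjoin M (u false 0)) (u true 0).

Lemma M_L1 : {subset M <= L1}.
Proof. by move=> y yM; do 2!apply: adjoin_base. Qed.

Lemma u_L1 s t : u s t \in L1.
Proof.
rewrite -[u s t](divfK (u_neq0 s 0)); apply: rpredM.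
  by apply: M_L1; apply: u_ratio.
by case: s; [apply: adjoin_gen | apply: adjoin_base; apply: adjoin_gen].
Qed.

Lemma L1_algebraic : {subset L1 <= algcl M}.
Proof.
have uM s : u s 0 \in algcl M.
  apply/algcl_polyP; exists ('X^q - (u s 0 ^+ q)%:P); split.
  - by rewrite rpredB ?polyOverXn ?polyOverC ?u0_power.
  - by rewrite -size_poly_gt0 size_XnsubC // q_gt0.
  - by apply/rootP; rewrite !hornerE subrr.
by apply: adjoin_min => //; apply: adjoin_min => //; apply: algcl_base.
Qed.

Lemma u_affine (S : divringClosed F) s : {subset M <= S} -> affine_over act S (u s 0).
Proof.
move=> MS g; have [k [c [c0 gE]]] := act_u g s.
exists (iota c * (u s k / u s 0)), 0; split.
- by apply/MS/rpredM; [apply: iota_M | apply: u_ratio].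
- exact: rpred0.
- by rewrite mulf_neq0 ?fmorph_eq0 // mulf_neq0 ?invr_eq0 ?u_neq0.
- by rewrite gE add0r addr0 -mulrA divfK ?u_neq0.
Qed.

Lemma L1_stable : act_stable act L1.
Proof.
apply: adjoin_stable; last by apply: u_affine; apply: adjoin_base.
by apply: adjoin_stable M_stable _; apply: u_affine.
Qed.

Lemma mvar_ratio s (t : 'Z_q) : mvar s t / mvar s 0 \in L1.
Proof.
rewrite -[t]natr_Zp; elim: (nat_of_ord t) => [|m IH].
  by rewrite divff ?mvar_neq0 ?rpred1.
have -> : mvar s m.+1%:R = u s m%:R * mvar s m%:R.
  by rewrite /u -[m.+1]addn1 natrD divfK ?mvar_neq0.
by rewrite -mulrA rpredM ?u_L1.
Qed.

Lemma scale_u s : exists g, forall s' t,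
  act g (u s' t) = (if s == s' then iota eta else 1) * u s' t.
Proof.
have [g [c gE]] := act_scale s; exists g => s' t.
rewrite /u fmorph_div !gE; case: eqP => _; last by rewrite !mul1r.
rewrite -mulf_div -fmorph_div; congr (iota _ * _).
rewrite !exprD !exprM -/eta eta_addZ !expr1 mulrA mulrAC divff ?mul1r //.
by rewrite mulf_neq0 ?expf_neq0 ?zeta_neq0.
Qed.

(** Such a [g] multiplies all transforms with the same first index by one scalar, which cancels in
    their quotients [w]. *)
Lemma scale_M s g y : (forall s' t,
    act g (u s' t) = (if s == s' then iota eta else 1) * u s' t) ->
  y \in M -> act g y = y.
Proof.
move=> gE yM; apply/eqP; rewrite -[_ == _]/(y \in fixpoints (act g)).
move: y yM; apply: gens_min => [_ /baseP[c ->]|]; first by apply/eqP.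
move=> _ /allpairsPdep[s' [j [_ _ ->]]]; apply/eqP.
pose e := if s == s' then iota eta else 1.
have e0 : e != 0.
  by rewrite /e; case: ifP; rewrite ?oner_eq0 // fmorph_eq0 expf_neq0 ?zeta_neq0.
have zE i : act g (z s' i) = e * z s' i.
  rewrite rmorph_sum mulr_sumr; apply: eq_bigr => t _.
  by rewrite rmorphM act_iota gE mulrCA.
by rewrite /w fmorph_div !zE -mulf_div divff ?mul1r.
Qed.

Lemma fixed_L1 : fixed act L1 =i fixed act M.
Proof.
have qF : q%:R != 0 :> F by rewrite -(rmorph_nat iota) fmorph_eq0.
have etaF : q.-primitive_root (iota eta) by rewrite fmorph_primitive_root eta_prim.
move=> y; apply/andP/andP => [[yL yG]|[/M_L1]//]; split=> //.
have yg g : act g y = y by apply/act_invariantP.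
(* The automorphism for [true] fixes both [M] and [u false 0], so it serves the upper Kummer step;
   the one for [false] serves the lower step. *)
have {}yL : y \in adjoin M (u false 0).
  have [g gE] := scale_u true.
  apply: (kummer_fixed etaF qF _ _ _ _ yL (yg g)).
  - by apply: adjoin_base; apply: iota_M.
  - by apply: adjoin_base; apply: u0_power.
  - move=> f fM; apply/eqP; rewrite -[_ == _]/(f \in fixpoints (act g)).
    move: f fM; apply: adjoin_min => [f fM|]; apply/eqP; first exact: scale_M gE _.
    by rewrite gE mul1r.
  - by rewrite gE.
have [g gE] := scale_u false.
apply: (kummer_fixed etaF qF _ _ _ _ yL (yg g)).
- exact: iota_M.
- exact: u0_power.
- by move=> f; apply: scale_M gE.
- by rewrite gE.
Qed.

Theorem rational_monomial : rational_invariants.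
Proof.
pose L := gens L1 [:: mvar false 0; mvar true 0].
have mvar0_L s : mvar s 0 \in L by apply: gens_gen; case: s; rewrite !inE eqxx ?orbT.
have mvar_L s t : mvar s t \in L.
  rewrite -[mvar s t](divfK (mvar_neq0 s 0)) rpredM //.
  by apply: gens_base; apply: mvar_ratio.
have mvar_affine (S : divringClosed F) s : {subset L1 <= S} ->
    affine_over act S (mvar s 0).
  move=> LS g; have [k [c [m gE]]] := act_mvar g s.
  exists (iota (zeta ^+ (c + q * m * (0%R : 'Z_q))) * (mvar s k / mvar s 0)), 0.
  split.
  - by apply/LS/rpredM; [apply/M_L1/iota_M | apply: mvar_ratio].
  - exact: rpred0.
  - rewrite mulf_neq0 ?fmorph_eq0 ?expf_neq0 ?zeta_neq0 //.
    by rewrite mulf_neq0 ?invr_eq0 ?mvar_neq0.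
  - by rewrite gE add0r addr0 -mulrA divfK ?mvar_neq0.
have L_affine : affine_chain act L1 [:: mvar false 0; mvar true 0].
  split; first exact: mvar_affine.
  by split=> //; apply: mvar_affine; apply: adjoin_base.
have L_stable : act_stable act L by apply: gens_stable L1_stable _.
have K0_L : {subset K0 <= L}.
  by move=> _ /baseP[c ->]; apply: gens_base; apply: M_L1; apply: iota_M.
pose bs := [seq map_mx iota (b i) | i <- enum {: bool * 'Z_q}].
have size_bs : size bs = (q + q)%N.
  by rewrite size_map -cardE card_prod card_bool card_ord Zp_cast // mul2n addnn.
have [fs [size_fs fsG fsL]] : exists fs, [/\ (size bs + size fs)%N = #|gT|,
    forall f, f \in fs -> act_invariant act f & forall g, x g \in gens L fs].
  apply: no_name L_stable _ _ _ _ => [g gL|_ i /mapP[j _ ->]|_ /mapP[[s t] _ ->]|].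
  - by apply: act_faithful => s t; apply: gL.
  - by rewrite mxE; apply: K0_L; apply: mem_base.
  - exact: mvar_L.
  - by rewrite free_family_rank // size_map -cardE.
pose ys := [:: mvar false 0, mvar true 0 & fs].
have ys_all f : f \in gens L1 ys.
  apply: (@all_in (gens L1 ys)) => // _ /baseP[c ->].
  by apply: gens_base; apply: M_L1; apply: iota_M.
(* There are 2(q - 1) quotients, two [mvar s 0] and |G| - 2q invariant forms, in all |G| elements
   over which the variables are algebraic: the whole list is independent. *)
have [ch_zs ch_ys] : chain K0 zs /\ chain M ys.
  apply/chain_cat; apply: x_generators_chain => [|g].
    rewrite size_cat size_zs -size_fs size_bs /=.
    by move: (size fs) (q.-1) (prednK q_gt0) => i j <-; rewrite !addnS !addSn.
  rewrite gens_cat; apply: gens_algcl; apply: gensS (ys_all _).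
  exact: L1_algebraic.
have ys_affine : affine_chain act L1 ys.
  rewrite -[ys]/([:: mvar false 0; mvar true 0] ++ fs).
  by case: L_affine => ? [? _]; do 2!split=> //; apply: invariant_affine_chain.
have [gs chg gsE] := miyata_chain actM base_stable ch_zs zs_affine.
(* Independence over [M] passes to its algebraic extension [L1], the base over which the action on
   [ys] is affine. *)
have [hs chh hsE] := miyata_chain actM L1_stable (chainW L1_algebraic ch_ys) ys_affine.
(* The two towers are glued by [fixed_L1]: [hs] starts from the invariants of [L1], which are those
   of [M], generated by [gs]. *)
exists (gs ++ hs) => [|f].
  apply/chain_cat; split.
    by apply: chainW chg => f; rewrite -fixed_base; apply: algcl_base.
  apply: chainW chh => f fg; apply: algcl_base; rewrite fixed_L1 gsE.
  by move: f fg; apply: gensS => f; rewrite fixed_base.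
have -> : act_invariant act f = (f \in fixed act (gens L1 ys)).
  by rewrite [RHS]inE /= ys_all.
rewrite hsE gens_cat; apply/idP/idP; apply: gensS => {}f; rewrite fixed_L1 gsE.
  by apply: gensS => {}f; rewrite fixed_base.
by apply: gensS => {}f; rewrite fixed_base.
Qed.

End Monomial.

(** * The monomial representations inside the regular one *)

Section MonomialCopy.

Variables (q : nat) (zeta : K).
Hypotheses (q_gt1 : (1 < q)%N) (zeta_prim : (q * q).-primitive_root zeta).
Hypothesis qK : q%:R != 0 :> K.
Variable f : gT -> {perm point q}.
Hypothesis fM : {morph f : g h / (g * h)%g}.
Hypothesis f_inj : injective f.
Hypothesis f_mono : forall g, is_mono (f g).
Hypothesis f_onto : forall h, h \in pgrp q -> exists g, f g = h.
Local Notation Q := (q * q)%N.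

Lemma zeta_val (n : nat) : zeta ^+ (n%:R : 'Z_Q) = zeta ^+ n.
Proof. by rewrite val_Zp_nat ?Q_gt1 // (prim_expr_mod zeta_prim). Qed.

Lemma zetaD (e e' : 'Z_Q) : zeta ^+ (e + e')%R = zeta ^+ e * zeta ^+ e'.
Proof. by rewrite -{1}(natr_Zp e) -{1}(natr_Zp e') -natrD zeta_val exprD. Qed.

Lemma zeta_eq1 (e : 'Z_Q) : zeta ^+ e = 1 -> e = 0.
Proof.
move=> /eqP; rewrite -(prim_order_dvd zeta_prim) => Qe.
by rewrite -(natr_Zp e) natr_Q_eq0.
Qed.

Lemma zetaX_neq0 n : zeta ^+ n != 0.
Proof. by rewrite expf_neq0 // (zeta_neq0 zeta_prim). Qed.

(** The linear form that reads the coordinate at [t = 0]; its values along the orbits of G embed the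
    representations in the regular one. *)
Definition coef (w : point q) : K :=
  let: (_, t, e) := w in if t == 0 then zeta ^+ e else 0.

Lemma coefE s t e : coef (s, t, e) = if t == 0 then zeta ^+ e else 0.
Proof. by []. Qed.

Definition orbit_sum (w : point q) : F := \sum_g iota (coef (f g w)) * x g.

Definition coef_row (i : bool * 'Z_q) : 'rV[K]_#|gT| :=
  \row_j coef (f (enum_val j) (i.1, i.2, 0)).

Lemma mvar_orbit_sum s t : mvar coef_row s t = orbit_sum (s, t, 0).
Proof.
rewrite /mvar /form /orbit_sum -(sum_enum_val (fun g => iota _ * x g)).
by apply: eq_bigr => i _; rewrite !mxE.
Qed.

(** The inverse turns the right action of permutations into a left one. *)
Lemma act_orbit_sum g w : act g (orbit_sum w) = orbit_sum (f g^-1%g w).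
Proof.
rewrite rmorph_sum [RHS](reindex_inj (mulgI g)); apply: eq_bigr => h _.
by rewrite rmorphM act_iota act_x -permM -fM mulKg.
Qed.

Lemma orbit_sumZ s t e : orbit_sum (s, t, e) = iota (zeta ^+ e) * orbit_sum (s, t, 0).
Proof.
rewrite mulr_sumr; apply: eq_bigr => g _; rewrite mulrA -rmorphM; congr (iota _ * _).
have [k [c [m gE]]] := f_mono g; rewrite !gE add0r !coefE.
case: eqP => _; last by rewrite mulr0.
by rewrite zetaD.
Qed.

(** A power of alpha_s moves the index [t0] to 0, where [coef] sees it, and keeps the index in the
    other representation. *)
Lemma f_palpha s t0 : exists (g : gT) (e : bool -> 'Z_q -> 'Z_Q), forall s' t e',
  f g (s', t, e') = (s', t + (if s' == s then - t0 else 0), e' + e s' t).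
Proof.
have [pa _ _] := pgrp_gens q s.
have [g gE] := f_onto (groupX (nat_of_ord (- t0)) pa).
exists g; eexists => s' t e'; rewrite gE palphaX monoE.
by case: (s' == s); rewrite ?mul0rn ?natr_Zp.
Qed.

(** Once [g] has moved [t] to 0, gamma_s multiplies the coefficient of (s, t) by zeta^q, different
    from 1, and changes no other. Subtracting the columns of [g * h] and [g] thus isolates
    [c (s, t)]. *)
Lemma coef_row_free (c : bool * 'Z_q -> K) :
  \sum_i c i *: coef_row i = 0 -> forall i, c i = 0.
Proof.
move=> sum0 [s t]; have [g [e gE]] := f_palpha s t.
have [_ _ pg] := pgrp_gens q s; have [h hE] := f_onto pg.
have col0 g' : \sum_i c i * coef (f g' (i.1, i.2, 0)) = 0.
  move/rowP/(_ (enum_rank g')): sum0; rewrite summxE mxE => sum0; rewrite -[RHS]sum0.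
  by apply: eq_bigr => i _; rewrite !mxE enum_rankK.
have zq : (zeta ^+ q == 1) = false.
  by rewrite -(prim_order_dvd zeta_prim) gtnNdvd ?ltn_Pmull // ltnW.
have := col0 (g * h)%g; rewrite -[RHS](col0 g) => /eqP; rewrite -subr_eq0 -sumrB.
rewrite (bigD1 (s, t)) //= big1 ?addr0 => [|[s' t'] /= st].
  rewrite -mulrBr fM permM !gE hE !pgammaE !coefE !eqxx subrr eqxx add0r zetaD.
  rewrite -{2}[zeta ^+ e s t]mulr1 -mulrBr !mulf_eq0 (negPf (zetaX_neq0 _)) /= subr_eq0.
  by rewrite zeta_val zq orbF => /eqP.
rewrite -mulrBr fM permM !gE hE !pgammaE.
have [e_s|s's] : s' == s \/ s' != s by case: (s' == s); [left|right].
  rewrite !(ifT _ _ e_s) !coefE subr_eq0.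
  case: eqP => [tt|_]; last by rewrite subrr mulr0.
  by rewrite (eqP e_s) tt eqxx in st.
by rewrite !(ifN _ _ s's) !addr0 subrr mulr0.
Qed.

Theorem rational_of_copy : rational_invariants.
Proof.
apply: (rational_monomial q_gt1 zeta_prim qK coef_row_free) => [g s|s|g gX].
- have [k [c [m gE]]] := f_mono g^-1%g.
  (* The sign of [m s] undoes the one in [slope]. *)
  exists (k s), (c s : nat), (- m s : 'Z_Q) => t.
  rewrite !mvar_orbit_sum act_orbit_sum gE add0r orbit_sumZ; congr (iota _ * _).
  rewrite zetaD exprD; congr (_ * _); rewrite -[RHS]zeta_val; congr (zeta ^+ _).
  rewrite mulnAC natrM natr_Zp.
  by rewrite /slope mulNr mulrN.
- have [_ pb _] := pgrp_gens q s; have [g gE] := f_onto pb.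
  (* The exponent of the inverse of beta_s is -(1 - q t) = -1 + q t, whence the constant -1. *)
  exists g, (- 1 : 'Z_Q)%R => s' t; rewrite !mvar_orbit_sum act_orbit_sum.
  have -> : f g^-1%g (s', t, 0) = (s', t, if s' == s then - 1 + (q * t)%:R else 0).
    apply: (@perm_inj _ (f g)); rewrite -permM -fM mulVg.
    have -> : f 1%g = 1%g by apply: (mulgI (f 1%g)); rewrite -fM !mulg1.
    rewrite perm1 gE pbetaE; case: (s' == s); last by rewrite addr0.
    by rewrite /slope addrACA addNr addrN addr0.
  rewrite orbit_sumZ eq_sym; case: (s == s'); last by rewrite expr0 rmorph1.
  by rewrite zetaD zeta_val exprD.
have f1 : f 1%g = 1%g by apply: (mulgI (f 1%g)); rewrite -fM !mulg1.
apply: invg_inj; rewrite invg1; apply: f_inj; rewrite f1.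
(* By independence of the variables, the point and its image have the same [coef] after every [f h].
   With [h] the power of alpha_s that moves [t] to 0, this value is non-zero and determines index
   and exponent. *)
have fix0 s t : f g^-1%g (s, t, 0) = (s, t, 0).
  have eq_coef h : coef (f h (f g^-1%g (s, t, 0))) = coef (f h (s, t, 0)).
    apply/eqP; rewrite -subr_eq0; apply/eqP.
    apply: (x_independent (c := fun h => coef (f h (f g^-1%g (s, t, 0)))
      - coef (f h (s, t, 0)))).
    have /eqP := gX s t; rewrite mvar_orbit_sum act_orbit_sum -subr_eq0 => /eqP e.
    rewrite -[RHS]e -sumrB; apply: eq_bigr => h' _.
    by rewrite rmorphB mulrBl.
  have [k [c [m gE]]] := f_mono g^-1%g; have [h [e hE]] := f_palpha s t.
  have := eq_coef h; rewrite gE !hE !coefE !eqxx subrr eqxx !add0r.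
  rewrite [t + k s]addrC addrK; case: eqP => [->|_ /esym/eqP]; last first.
    by rewrite (negPf (zetaX_neq0 _)).
  rewrite add0r zetaD -{2}[zeta ^+ e s t]mul1r.
  by move=> /(mulIf (zetaX_neq0 _))/zeta_eq1 ->.
apply/permP => -[[s t] e]; rewrite perm1.
have [k [c [m gE]]] := f_mono g^-1%g.
have /eqP := fix0 s t; rewrite !gE add0r !xpair_eqE eqxx => /andP[/eqP-> /eqP->].
by rewrite addr0.
Qed.

End MonomialCopy.
End RegularAction.

(** * The rational function field of the regular action *)

Section FixedField.

Variables (K : fieldType) (gT : finGroupType).

Definition ract (g : gT) : {rmorphism ratfun K #|gT| -> ratfun K #|gT|} :=
  @ratact K gT g.

Lemma ractM g h f : ract (g * h)%g f = ract g (ract h f).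
Proof. by rewrite /ract /= ratactM. Qed.

Lemma xvar_chain : chain (base (@ratfunC K #|gT|)) [seq xvar K g | g <- enum gT].
Proof.
have -> : [seq xvar K g | g <- enum gT] =
    [seq ('X_i)%:F | i <- [seq enum_rank g | g <- enum gT]].
  by rewrite -[RHS]map_comp.
by apply: chain_vars; rewrite map_inj_uniq ?enum_uniq //; apply: enum_rank_inj.
Qed.

Lemma xvar_gens f : f \in gens (base (@ratfunC K #|gT|)) [seq xvar K g | g <- enum gT].
Proof.
move: f (gens_vars f); apply: gens_min => [f|_ /mapP[i _ ->]]; first exact: gens_base.
apply: gens_gen; apply/mapP; exists (enum_val i); first by rewrite mem_enum.
by rewrite /xvar enum_valK.
Qed.

Lemma rational_fixed_field :
  rational_invariants (@ratfunC K #|gT|) ract -> rational_over (fixed_fieldC K gT).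
Proof.
move=> [fs ch fsE]; apply: (chain_rational (iota := @ratfunC K #|gT|) _ ch) => //.
Qed.

End FixedField.

Theorem theorem4p8 (p r : nat) (p_prime : prime p) (r_ge1 : (1 <= r)%N)
  (gT : finGroupType)
  (isoG : ([set: gT] \isog Grp
     (alpha1 : alpha2 : beta1 : beta2 : gamma1 : gamma2 :
       [~ beta1, alpha1] = gamma1 = beta1 ^+ (p ^ r)%N,
       [~ beta2, alpha2] = gamma2 = beta2 ^+ (p ^ r)%N,
       [~ alpha1, alpha2] = gamma2,
       gamma1 ^+ (p ^ r)%N = 1, gamma2 ^+ (p ^ r)%N = 1,
       alpha1 ^+ (p ^ r)%N = 1, alpha2 ^+ (p ^ r)%N = 1,
       [~ alpha1, beta2] = 1, [~ alpha1, gamma1] = 1, [~ alpha1, gamma2] = 1,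
       [~ alpha2, beta1] = 1, [~ alpha2, gamma1] = 1, [~ alpha2, gamma2] = 1,
       [~ beta1, beta2] = 1, [~ beta1, gamma1] = 1, [~ beta1, gamma2] = 1,
       [~ beta2, gamma1] = 1, [~ beta2, gamma2] = 1,
       [~ gamma1, gamma2] = 1))%g)
  (K : fieldType)
  (K_hyp : p \in [pchar K] \/
     (p \notin [pchar K] /\
      exists zeta : K, (p ^ (2 * r))%N.-primitive_root zeta)) :
  rational_over (fixed_fieldC K gT).
Proof.
have relsG := (homg_Gr _ _).1 (isoGrp_hom isoG).
have act_c (g : gT) (c : K) : ract K g (ratfunC _ c) = ratfunC _ c by exact: ratactC.
have act_x (g h : gT) : ract K g (xvar K h) = xvar K (g * h)%g by exact: ratactX.
apply: rational_fixed_field; case: K_hyp => [pK|[pK [zeta zeta_prim]]].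
  exact: (rational_char_p (@ractM K gT) act_c act_x (@xvar_chain K gT)
    (@xvar_gens K gT) pK (Gr_pgroup p_prime relsG)).
have q_gt1 : (1 < p ^ r)%N by rewrite -(exp1n r) ltn_exp2r ?prime_gt1.
have qK : (p ^ r)%:R != 0 :> K.
  by rewrite natrX expf_neq0 //; move: pK; rewrite inE p_prime.
(* A presented group maps onto every group generated by elements that satisfy its relations. *)
have homP : (pgrp (p ^ r) \homg [set: gT])%g.
  rewrite (isoG _ (pgrp_group (p ^ r))); apply: (homg_Gr _ _).2.
  exists (palpha _ false), (palpha _ true), (pbeta _ false), (pbeta _ true).
  by exists (pgamma _ false), (pgamma _ true); split=> //; apply: pgrp_relations.
have [f [fM f_inj f_mono f_onto]] := Gr_copy q_gt1 relsG homP.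
rewrite mulSn mul1n expnD in zeta_prim.
exact: (rational_of_copy (@ractM K gT) act_c act_x (@xvar_chain K gT)
  (@xvar_gens K gT) q_gt1 zeta_prim qK fM f_inj f_mono f_onto).
Qed.
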